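(* Let $K\subset\mathbb{R}^2$ be the closed convex set defined from a sequence $\{\alpha_n\}_{n\ge1}$ as described in the context, and let $\Pi=\Pi(\cdot;K)$ be the metric projection onto $K$. (Case B) If $\alpha_n=C\lambda^n$ for all $n$, with $C>0$ and $\lambda\in(0,1)$, then $\partial K$ is $C^{1,1}$ around $(1,0)$, and the directional derivative $D_v\Pi$ does not exist at the point $(2,0)$ for $v=(0,1)$. (Case C) If $\alpha_n=C\lambda^{n^2}$ for all $n$, with $C>0$ and $\lambda\in(0,1/2)$, then $\partial K$ is $C^1$ but not $C^{1,1}$ around $(1,0)$, and the directional derivative $D_v\Pi$ does not exist at the point $(2,0)$ for $v=(0,1)$.
   Context: Identify $\mathbb{R}^2$ (Euclidean norm $\|\cdot\|$) with $\mathbb{C}$. A sequence defining $K$ is a strictly decreasing sequence $\{\alpha_n\}_{n\ge1}\subset(0,\pi/2]$ with $\alpha_1=\pi/2$, $\lim_{n\to\infty}\alpha_n=0$, and $\alpha_{n+1}\le\frac{\alpha_n+\alpha_{n+2}}{2}$ for all $n\ge 1$. (In Cases B, C the constant $C$ is thus the one for which $\alpha_1=\pi/2$.) Construction of $K$: put $A_n=e^{i\alpha_n}$. For $n\ge1$ let $T_n$ be the midpoint of the segment $A_nA_{n+1}$. For $n\ge2$ let $S_n$ be the point of the segment $A_{n-1}A_n$ with $\|A_n-S_n\|=\|A_n-T_n\|=\sin\left(\frac{\alpha_n-\alpha_{n+1}}{2}\right)$. For $n\ge 2$ let $C_n$ be the circular arc with endpoints $S_n$ and $T_n$, contained in the triangle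 $S_nA_nT_n$, tangent to the segment $A_nS_n$ at $S_n$ and to the segment $T_nA_n$ at $T_n$ (it replaces these two segments). Let $J_1$ be the convex hull of the points $0$ and $1$, the arcs $C_n$ ($n\ge2$), and the line segments connecting them, namely the segment $A_1S_2$ (with $A_1=i$) and the segments $T_nS_{n+1}$ ($n\ge2$). Let $J_2$ be the reflection of $J_1$ in the real axis, let $J_3$ be the reflection of $J_1\cup J_2$ in the imaginary axis, and set $K=J_1\cup J_2\cup J_3$. Boundary regularity: let $x:[-1,1]\to\mathbb{R}$ be the function such that $\{(x(y),y):y\in[-1,1]\}=\partial K\cap\{(x,y):x\ge0\}$. ''$\partial K$ is $C^1$ around $(1,0)$'' means $x(\cdot)$ is continuously differentiable near $0$; ''$\partial K$ is $C^{1,1}$ around $(1,0)$'' means that in addition $x'$ is Lipschitz on a neighborhood of $0$. For $z\in\mathbb{R}^2$, $\Pi(z)=\Pi(z;K)$ is the unique point of $K$ nearest to $z$. For $x_0\notin K$ and $v\in\mathbb{R}^2$, the directional derivative is $D_v\Pi(x_0):=\lim_{t\to0+}\frac{\Pi(x_0+tv)-\Pi(x_0)}{t}$, when this limit exists. *)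

(* Defs.v *)
(* Stdlib reals with Coquelicot.  The plane is Coquelicot's [C] (that is, R * R)
   with the Euclidean norm [Cmod]. *)
From Stdlib Require Import Reals ClassicalEpsilon.
From Coquelicot Require Import Coquelicot.
Open Scope R_scope.

Definition dot (p q : C) : R := Re p * Re q + Im p * Im q.

Definition segment (p q : C) : C -> Prop :=
  fun z => exists t : R, 0 <= t <= 1 /\ z = ((1 - t)%R * p + t * q)%C.

Definition convex (E : C -> Prop) : Prop :=
  forall p q z : C, E p -> E q -> segment p q z -> E z.

Definition convex_hull (E : C -> Prop) : C -> Prop :=
  fun z => forall D : C -> Prop,
    convex D -> (forall w : C, E w -> D w) -> D z.

Definition triangle (p q s : C) : C -> Prop :=
  convex_hull (fun z => z = p \/ z = q \/ z = s).

(* The circle with center [c] and radius [r] passes through [s] and [t] and is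
   tangent there to the lines [s a] and [a t]. *)
Definition tangent_circle (s a t c : C) (r : R) : Prop :=
  0 < r /\ Cmod (s - c)%C = r /\ Cmod (t - c)%C = r /\
  dot (s - c)%C (a - s)%C = 0 /\ dot (t - c)%C (a - t)%C = 0.

(* For a nondegenerate triangle with |a s| = |a t| there is exactly one such
   circle.  The chord [s t] cuts it into two arcs; the one on the side of [a]
   lies in the triangle [s a t], and the other one meets the triangle only in
   its endpoints [s] and [t].  So the arc with endpoints [s] and [t] contained
   in the triangle is the intersection of the circle with the triangle. *)
Definition tangent_arc (s a t : C) : C -> Prop :=
  fun z => triangle s a t z /\
    exists (c : C) (r : R), tangent_circle s a t c r /\ Cmod (z - c)%C = r.

Definition boundary (E : C -> Prop) : C -> Prop :=
  fun p => ~ locally p E /\ ~ locally p (fun q => ~ E q).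

(* Sequences are indexed from 1: the value [alpha 0] is never used. *)
Definition defining_sequence (alpha : nat -> R) : Prop :=
  alpha 1%nat = PI / 2 /\
  (forall n, (1 <= n)%nat -> 0 < alpha n <= PI / 2) /\
  (forall n, (1 <= n)%nat -> alpha (S n) < alpha n) /\
  is_lim_seq alpha 0 /\
  (forall n, (1 <= n)%nat ->
     alpha (S n) <= (alpha n + alpha (S (S n))) / 2).

Definition ptA (alpha : nat -> R) (n : nat) : C := (cos (alpha n), sin (alpha n)).

Definition ptT (alpha : nat -> R) (n : nat) : C := ((ptA alpha n + ptA alpha (S n)) / 2)%C.

(* The point of the ray from [ptA n] to [ptA (n - 1)] at distance
   sin ((alpha n - alpha (n + 1)) / 2) from [ptA n]; it lies on the segment
   because the differences of a defining sequence are nonincreasing.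
   Meaningful for 2 <= n. *)
Definition ptS (alpha : nat -> R) (n : nat) : C :=
  (ptA alpha n
   + (sin ((alpha n - alpha (S n)) / 2) / Cmod (ptA alpha (pred n) - ptA alpha n)%C)%R
     * (ptA alpha (pred n) - ptA alpha n))%C.

Definition arc (alpha : nat -> R) (n : nat) : C -> Prop := tangent_arc (ptS alpha n) (ptA alpha n) (ptT alpha n).

Definition J1 (alpha : nat -> R) : C -> Prop :=
  convex_hull (fun z =>
    z = RtoC 0 \/ z = RtoC 1 \/
    (exists n, (2 <= n)%nat /\ arc alpha n z) \/
    segment (ptA alpha 1) (ptS alpha 2) z \/
    (exists n, (2 <= n)%nat /\ segment (ptT alpha n) (ptS alpha (S n)) z)).

(* Reflections are involutions, so the image of a set is also its preimage. *)
Definition J2 (alpha : nat -> R) : C -> Prop := fun z => J1 alpha (Cconj z).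

Definition J3 (alpha : nat -> R) : C -> Prop :=
  fun z => J1 alpha (- Cconj z)%C \/ J2 alpha (- Cconj z)%C.

Definition setK (alpha : nat -> R) : C -> Prop := fun z => J1 alpha z \/ J2 alpha z \/ J3 alpha z.

(* [x] describes the right half of the boundary of [E] as a graph over [-1, 1];
   this determines [x] on [-1, 1] only, and its other values are irrelevant. *)
Definition right_boundary_fun (E : C -> Prop) (x : R -> R) : Prop :=
  forall p : C,
    (boundary E p /\ 0 <= Re p) <-> (-1 <= Im p <= 1 /\ Re p = x (Im p)).

Definition C1_near (f : R -> R) (a : R) : Prop :=
  locally a (fun y => ex_derive f y /\ continuous (Derive f) y).

Definition C11_near (f : R -> R) (a : R) : Prop :=
  C1_near f a /\
  exists L eps : R, 0 < eps /\
    forall y z : R, Rabs (y - a) < eps -> Rabs (z - a) < eps ->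
      Rabs (Derive f y - Derive f z) <= L * Rabs (y - z).

Definition boundary_C1 (E : C -> Prop) : Prop :=
  exists x : R -> R, right_boundary_fun E x /\ C1_near x 0.

Definition boundary_C11 (E : C -> Prop) : Prop :=
  exists x : R -> R, right_boundary_fun E x /\ C11_near x 0.

Definition nearest (E : C -> Prop) (z p : C) : Prop :=
  E p /\ forall q : C, E q -> Cmod (z - p)%C <= Cmod (z - q)%C.

(* The unique nearest point; an arbitrary value if there is none. *)
Definition proj (E : C -> Prop) (z : C) : C :=
  epsilon (inhabits (RtoC 0)) (unique (nearest E z)).

Definition ex_dir_derive (f : C -> C) (v x0 : C) : Prop :=
  exists l : C,
    filterlim (fun t : R => ((f (x0 + t * v) - f x0) / t)%C)
      (at_right 0) (locally l).

(* Main.v *)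
(* The first-quadrant part of K is the intersection of its tangent halfplanes: with beta_n the
   angle of the outer normal of the edge A_n A_{n+1}, the arc at A_{k+1} carries the normal angles
   t in [beta_{k+1}, beta_k] and lies on a circle of radius
   r_k = sin ((alpha_{k+1} - alpha_{k+2}) / 2) / tan ((beta_k - beta_{k+1}) / 2).
   Regularity needs no gluing of pieces.  The halfplanes say that - tan t is a supergradient of
   the concave boundary function at the point of normal angle t, and a function with a continuous
   supergradient is C^1 with that derivative.  As a function of the height y, sin t grows at rate
   1/r_k along the k-th arc and is constant along edges; hence it is always continuous, it is
   Lipschitz when the r_k are bounded below (alpha_n geometric), and it is not Lipschitz at 0 when
   r_k tends to 0 (alpha_{n+1} / alpha_n tends to 0).
   For the projection, the normal at T_n passes through 0, so T_n is the projection of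
   (2, 2 tan beta_n) and the difference quotient tends to 1/2 along these points.  Along the
   points of the line x = 2 that project to the S_n it stays below a constant less than 1/2. *)
From Stdlib Require Import Reals Lra Lia Psatz Classical ClassicalEpsilon.
From Coquelicot Require Import Coquelicot.
Require Import Defs.
Open Scope R_scope.

(** * Preliminaries on plane convexity, the tangent and nearest points *)

Definition unit (t : R) : C := (cos t, sin t).

Ltac plane := unfold Cdiv, Cminus, Cplus, Copp, Cmult, Cinv, RtoC, dot, Re, Im, unit; simpl.

Lemma Cmod_pow2 (z : C) : Cmod z ^ 2 = Re z ^ 2 + Im z ^ 2.
Proof. unfold Cmod; rewrite pow2_sqrt; [reflexivity|destruct z; plane; nra]. Qed.

Lemma segment_l (p q : C) : segment p q p.
Proof. exists 0; split; [lra|]. destruct p, q; plane; f_equal; ring. Qed.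

Lemma convex_hull_incl (E : C -> Prop) (z : C) : E z -> convex_hull E z.
Proof. intros Hz D _ HD; auto. Qed.

Lemma convex_convex_hull (E : C -> Prop) : convex (convex_hull E).
Proof.
  intros p q z Hp Hq Hz D HD HE; exact (HD p q z (Hp D HD HE) (Hq D HD HE) Hz).
Qed.

Lemma triangle_barycentric (p q s : C) (a b c : R) :
  0 <= a -> 0 <= b -> 0 <= c -> a + b + c = 1 ->
  triangle p q s (a * p + b * q + c * s)%C.
Proof.
  intros Ha Hb Hc Hs.
  assert (Hp : triangle p q s p) by (apply convex_hull_incl; auto).
  assert (Hq : triangle p q s q) by (apply convex_hull_incl; auto).
  assert (Hr : triangle p q s s) by (apply convex_hull_incl; auto).
  destruct (Req_dec (b + c) 0) as [H0|H0].
  - replace b with 0 by lra. replace c with 0 by lra. replace a with 1 by lra.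
    replace (_ + _)%C with p; [exact Hp|]. ring.
  - apply (convex_convex_hull _ p ((b / (b + c))%R * q + (c / (b + c))%R * s)%C); [exact Hp| |].
    + apply (convex_convex_hull _ q s); [exact Hq|exact Hr|].
      exists (c / (b + c)); split.
      * split; [apply Rdiv_le_0_compat; lra|].
        apply (Rmult_le_reg_r (b + c)); [lra|].
        replace (c / (b + c) * (b + c)) with c by (field; lra). lra.
      * replace (1 - c / (b + c)) with (b / (b + c)) by (field; lra). reflexivity.
    + exists (b + c); split; [lra|].
      destruct p, q, s; plane; f_equal; replace a with (1 - b - c) by lra; field; lra.
Qed.

(** The supergradient inequalities at [y] and at [y + h], each tested at the other point, squeeze
    the difference quotient between [s y] and [s (y + h)]; continuity of [s] closes the gap. *)
Lemma supergradient_is_derive (f s : R -> R) (a b y : R) :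
  a < y < b ->
  (forall u v, a < u < b -> a < v < b -> f v <= f u + s u * (v - u)) ->
  continuous s y -> is_derive f y (s y).
Proof.
  intros Hy Hsup Hs; apply is_derive_Reals; intros eps Heps.
  apply continuity_pt_filterlim in Hs; destruct (Hs eps Heps) as (d & Hd & Hcont).
  assert (Hm : 0 < Rmin d (Rmin (y - a) (b - y))) by (repeat apply Rmin_pos; lra).
  exists (mkposreal _ Hm); intros h Hh0 Hh; simpl in Hh.
  assert (Hh1 := Rlt_le_trans _ _ _ Hh (Rmin_l _ _)).
  assert (Hh2 := Rlt_le_trans _ _ _ Hh (Rle_trans _ _ _ (Rmin_r _ _) (Rmin_l _ _))).
  assert (Hh3 := Rlt_le_trans _ _ _ Hh (Rle_trans _ _ _ (Rmin_r _ _) (Rmin_r _ _))).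
  apply Rabs_def2 in Hh2; apply Rabs_def2 in Hh3.
  pose proof (Hsup y (y + h) Hy ltac:(lra)) as H1.
  pose proof (Hsup (y + h) y ltac:(lra) Hy) as H2.
  assert (H3 : Rabs (s (y + h) - s y) < eps).
  { apply Hcont; split; [split; [exact I|lra]|].
    simpl; unfold Rdist; replace (y + h - y) with h by ring; exact Hh1. }
  apply Rle_lt_trans with (2 := H3).
  replace (f (y + h)) with (f y + h * s y + ((f (y + h) - f y - h * s y) / h) * h) by (field; exact Hh0).
  set (q := (f (y + h) - f y - h * s y) / h).
  replace ((f y + h * s y + q * h - f y) / h - s y) with q by (field; exact Hh0).
  assert (Eq : f (y + h) = f y + h * s y + q * h) by (unfold q; field; exact Hh0).
  rewrite Eq in H1, H2.
  destruct (Rlt_dec 0 h).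
  - assert (q <= 0) by nra. assert (s (y + h) - s y <= q) by nra.
    rewrite !Rabs_left1 by lra; lra.
  - assert (h < 0) by lra. assert (0 <= q) by nra. assert (q <= s (y + h) - s y) by nra.
    rewrite !Rabs_pos_eq by lra; lra.
Qed.

(** Arcs control the sine of the normal angle, whereas the boundary slope is its tangent. This bound
    passes a Lipschitz estimate from slopes to sines; the next lemma goes the other way. *)
Lemma tan_asin_expand (u v : R) : 0 <= u -> u <= v < 1 ->
  v - u <= tan (asin v) - tan (asin u).
Proof.
  intros Hu Hv; rewrite !tan_asin by lra; unfold Rsqr.
  assert (H1 : 0 < sqrt (1 - v * v)) by (apply sqrt_lt_R0; nra).
  assert (H2 : sqrt (1 - v * v) <= sqrt (1 - u * u)) by (apply sqrt_le_1_alt; nra).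
  assert (H3 : sqrt (1 - u * u) <= 1)
    by (apply Rle_trans with (sqrt 1); [apply sqrt_le_1_alt; nra|rewrite sqrt_1; lra]).
  set (c := sqrt (1 - v * v)) in *; set (d := sqrt (1 - u * u)) in *.
  apply Rle_trans with ((v - u) / d).
  - apply (Rmult_le_reg_r d); [lra|]; unfold Rdiv; rewrite Rmult_assoc, Rinv_l; nra.
  - replace ((v - u) / d) with (v / d - u / d) by (field; lra).
    apply Rplus_le_compat_r; unfold Rdiv; apply Rmult_le_compat_l; [lra|].
    apply Rinv_le_contravar; lra.
Qed.

Lemma tan_asin_lipschitz (q : R) : 0 <= q < 1 ->
  exists M, 0 <= M /\ forall u v, 0 <= u <= q -> 0 <= v <= q ->
    Rabs (tan (asin u) - tan (asin v)) <= M * Rabs (u - v).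
Proof.
  intros Hq; assert (Hc : 0 < sqrt (1 - q * q)) by (apply sqrt_lt_R0; nra).
  (* The derivative of u / sqrt(1 - u^2) is (1 - u^2)^(-3/2), largest at [q]. *)
  set (c := sqrt (1 - q * q)) in *; exists (/ (c * c * c)).
  assert (H0 : 0 < c * c * c) by (repeat apply Rmult_lt_0_compat; exact Hc).
  split; [apply Rlt_le, Rinv_0_lt_compat; exact H0|].
  assert (W : forall u v, 0 <= u -> u <= v <= q ->
    0 <= tan (asin v) - tan (asin u) <= / (c * c * c) * (v - u)).
  { intros u v Hu Hv.
    pose proof (tan_asin_expand u v Hu ltac:(lra)); split; [lra|].
    rewrite !tan_asin by lra; unfold Rsqr.
    assert (H1 : c <= sqrt (1 - v * v)) by (apply sqrt_le_1_alt; nra).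
    assert (H2 : sqrt (1 - v * v) <= sqrt (1 - u * u)) by (apply sqrt_le_1_alt; nra).
    assert (E1 := sqrt_sqrt (1 - v * v) ltac:(nra)); assert (E2 := sqrt_sqrt (1 - u * u) ltac:(nra)).
    set (a := sqrt (1 - v * v)) in *; set (b := sqrt (1 - u * u)) in *.
    assert (HD0 : 0 <= v * b - u * a) by nra.
    (* Multiplying by [v * b + u * a] rationalises: the product is v^2 - u^2. *)
    assert (HD : c * (v * b - u * a) <= v - u).
    { destruct (Req_dec (u + v) 0) as [E|E]; [replace v with 0 by lra; replace u with 0 by lra; lra|].
      apply (Rmult_le_reg_r (u + v)); [lra|].
      apply Rle_trans with ((v * b - u * a) * (v * b + u * a)).
      - assert (c * (u + v) <= v * b + u * a) by nra.
        apply Rle_trans with ((v * b - u * a) * (c * (u + v))); [lra|].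
        apply Rmult_le_compat_l; assumption.
      - replace ((v * b - u * a) * (v * b + u * a)) with (v * v * (b * b) - u * u * (a * a)) by ring.
        rewrite E1, E2; lra. }
    assert (Hab : c * c <= a * b) by nra.
    replace (v / a - u / b) with ((v * b - u * a) / (a * b)) by (field; lra).
    apply (Rmult_le_reg_r (a * b)); [nra|].
    unfold Rdiv at 1; rewrite Rmult_assoc, Rinv_l, Rmult_1_r by nra.
    apply (Rmult_le_reg_l (c * c * c)); [exact H0|].
    replace (c * c * c * (/ (c * c * c) * (v - u) * (a * b))) with ((v - u) * (a * b)) by (field; lra).
    apply Rle_trans with ((v - u) * (c * c)); [|apply Rmult_le_compat_l; lra].
    replace (c * c * c * (v * b - u * a)) with ((c * (v * b - u * a)) * (c * c)) by ring.
    apply Rmult_le_compat_r; nra. }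
  intros u v Hu Hv; destruct (Rle_dec u v).
  - pose proof (W u v ltac:(lra) ltac:(lra)); rewrite !Rabs_left1 by lra; lra.
  - pose proof (W v u ltac:(lra) ltac:(lra)); rewrite !Rabs_pos_eq by lra; lra.
Qed.

Lemma le_tan (t : R) : 0 <= t < PI / 2 -> t <= tan t.
Proof.
  intros Ht; pose proof PI_RGT_0.
  assert (Hcos : forall c, Rmin 0 t <= c <= Rmax 0 t -> cos c <> 0).
  { intros c; rewrite Rmin_left, Rmax_right by lra; intros Hc.
    apply Rgt_not_eq, cos_gt_0; lra. }
  destruct (MVT_gen tan 0 t (fun c => tan c ^ 2 + 1)) as (c & _ & E).
  - intros c Hc; apply is_derive_tan, Hcos; lra.
  - intros c Hc; apply continuity_pt_filterlim, (ex_derive_continuous tan).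
    eexists; apply is_derive_tan, Hcos; exact Hc.
  - rewrite tan_0 in E; pose proof (pow2_ge_0 (tan c)); nra.
Qed.

Lemma sin_ge_half (t : R) : 0 <= t <= 1 -> t / 2 <= sin t.
Proof.
  intros Ht; destruct (pre_sin_bound t 0) as [H _]; [lra|lra|].
  unfold sin_approx, sin_term in H; simpl in H; nra.
Qed.

(** The obtuse angle condition gives |z - p|^2 + |q - p|^2 <= |z - q|^2, hence both minimality and
    uniqueness, which pins down the choice made in [proj]. *)
Lemma proj_of_halfplane (E : C -> Prop) (z p : C) :
  E p -> (forall q, E q -> dot (q - p)%C (z - p)%C <= 0) -> proj E z = p.
Proof.
  intros Hp Hdot.
  assert (Hsq : forall q, E q -> Cmod (z - p)%C ^ 2 + Cmod (q - p)%C ^ 2 <= Cmod (z - q)%C ^ 2).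
  { intros q Hq; specialize (Hdot q Hq); rewrite !Cmod_pow2.
    destruct z, p, q; revert Hdot; plane; lra. }
  assert (Hnear : nearest E z p).
  { split; [exact Hp|]; intros q Hq; specialize (Hsq q Hq).
    pose proof (Cmod_ge_0 (z - p)%C); pose proof (Cmod_ge_0 (z - q)%C).
    pose proof (pow2_ge_0 (Cmod (q - p)%C)); nra. }
  assert (Huniq : unique (nearest E z) p).
  { split; [exact Hnear|]; intros q [Hq Hqn]; specialize (Hsq q Hq); specialize (Hqn p Hp).
    pose proof (Cmod_ge_0 (z - p)%C); pose proof (Cmod_ge_0 (z - q)%C).
    assert (Hz : Cmod (q - p)%C ^ 2 = 0) by (pose proof (pow2_ge_0 (Cmod (q - p)%C));
      pose proof (pow_incr _ _ 2 (conj (Cmod_ge_0 (z - q)%C) Hqn)); lra).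
    assert (Hz0 : Cmod (q - p)%C = 0) by (pose proof (Cmod_ge_0 (q - p)%C); nra).
    apply Cmod_eq_0 in Hz0; replace q with ((q - p) + p)%C by ring; rewrite Hz0; ring. }
  exact (proj2 (epsilon_spec (inhabits (RtoC 0)) (unique (nearest E z)) (ex_intro _ p Huniq)) p Hnear).
Qed.

(** Two step sequences whose vertical quotients have different limits will refute the existence of
    the directional derivative. *)
Lemma dir_derive_seq (f : C -> C) (v x0 l : C) (u : nat -> R) :
  filterlim (fun t : R => ((f (x0 + t * v) - f x0) / t)%C) (at_right 0) (locally l) ->
  (forall n, 0 < u n) -> is_lim_seq u 0 ->
  is_lim_seq (fun n => (Im (f (x0 + u n * v)%C) - Im (f x0)) / u n) (Im l).
Proof.
  intros Hl Hu Hlim.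
  assert (Hright : filterlim u eventually (at_right 0)).
  { intros P [e He]; destruct (proj2 (is_lim_seq_spec _ _) Hlim e) as [N HN].
    exists N; intros n Hn; apply He; [exact (HN n Hn)|apply Hu]. }
  pose proof (filterlim_comp _ _ _ _ _ _ _ _ Hright Hl) as H.
  apply is_lim_seq_spec; intros e.
  destruct (H (fun z => Rabs (Im z - Im l) < e)) as [N HN].
  { exists e; intros z [_ Hz]; exact Hz. }
  exists N; intros n Hn; specialize (HN n Hn); pose proof (Hu n) as Hun.
  replace (Im ((f (x0 + u n * v) - f x0) / u n)%C)
    with ((Im (f (x0 + u n * v)%C) - Im (f x0)) / u n) in HN; [exact HN|].
  destruct (f (x0 + u n * v)%C), (f x0); plane; field; lra.
Qed.

(** * Angles, corners and tangent arcs of the construction *)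

Section Construction.

Variable alpha : nat -> R.
Hypothesis Halpha : defining_sequence alpha.

Definition beta (n : nat) : R := (alpha n + alpha (S n)) / 2.
(** Half the central angle of the chord from [ptA n] to [ptA (S n)], which is at distance
    [cos (delta n)] from 0 and has half-length [sin (delta n)]. *)
Definition delta (n : nat) : R := (alpha n - alpha (S n)) / 2.

(* [rad k] and [(cenx k, ceny k)] are the radius and the centre of the arc at the corner
   [ptA (S k)]: corners are indexed by [1 <= k], and [onarc k t] lies on the arc when
   [beta (S k) <= t <= beta k], [t] being the angle of the outer normal. *)
Definition rad (k : nat) : R := sin (delta (S k)) / tan ((beta k - beta (S k)) / 2).
Definition cenx (k : nat) : R := (cos (delta (S k)) - rad k) * cos (beta (S k)).
Definition ceny (k : nat) : R := (cos (delta (S k)) - rad k) * sin (beta (S k)).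
Definition onarc (k : nat) (t : R) : C := (cenx k + rad k * cos t, ceny k + rad k * sin t).

Lemma alpha_pos n : (1 <= n)%nat -> 0 < alpha n.
Proof. intros Hn; apply Halpha; exact Hn. Qed.

Lemma alpha_le n : (1 <= n)%nat -> alpha n <= PI / 2.
Proof. intros Hn; apply Halpha; exact Hn. Qed.

Lemma alpha_dec n : (1 <= n)%nat -> alpha (S n) < alpha n.
Proof. intros Hn; apply Halpha; exact Hn. Qed.

Lemma alpha_mono m n : (1 <= m <= n)%nat -> alpha n <= alpha m.
Proof.
  intros [Hm Hn]; induction Hn as [|n Hn IH]; [lra|].
  pose proof (alpha_dec n ltac:(lia)); lra.
Qed.

(** Here the convexity condition on the sequence enters. It keeps [ptS (S k)] from passing beyond
    [ptT k], so that consecutive arcs do not overlap along an edge. *)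
Lemma delta_dec k : (1 <= k)%nat -> delta (S k) <= delta k.
Proof.
  intros Hk; unfold delta.
  destruct Halpha as (_ & _ & _ & _ & H); specialize (H k Hk); lra.
Qed.

Lemma delta_bounds n : (1 <= n)%nat -> 0 < delta n < PI / 4.
Proof.
  intros Hn; unfold delta.
  pose proof (alpha_dec n Hn); pose proof (alpha_le n Hn).
  pose proof (alpha_pos (S n) ltac:(lia)); lra.
Qed.

Lemma beta_bounds n : (1 <= n)%nat -> 0 < beta n < PI / 2.
Proof.
  intros Hn; unfold beta.
  pose proof (alpha_dec n Hn); pose proof (alpha_le n Hn).
  pose proof (alpha_pos (S n) ltac:(lia)); lra.
Qed.

Lemma beta_dec n : (1 <= n)%nat -> beta (S n) < beta n.
Proof.
  intros Hn; unfold beta.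
  pose proof (alpha_dec n Hn); pose proof (alpha_dec (S n) ltac:(lia)); lra.
Qed.

Lemma beta_lim : is_lim_seq beta 0.
Proof.
  destruct Halpha as (_ & _ & _ & H & _).
  replace 0 with ((0 + 0) / 2) by lra.
  unfold beta, Rdiv.
  apply (is_lim_seq_scal_r (fun n => alpha n + alpha (S n)) (/ 2) (0 + 0)).
  apply (is_lim_seq_plus' _ _ 0 0); [exact H|].
  apply is_lim_seq_incr_1 in H; exact H.
Qed.

Lemma sin_delta_pos n : (1 <= n)%nat -> 0 < sin (delta n).
Proof. intros Hn; pose proof (delta_bounds n Hn); pose proof PI_RGT_0; apply sin_gt_0; lra. Qed.

Lemma sin_delta_dec k : (1 <= k)%nat -> sin (delta (S k)) <= sin (delta k).
Proof.
  intros Hk; pose proof (delta_bounds k Hk); pose proof (delta_bounds (S k) ltac:(lia)).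
  pose proof (delta_dec k Hk); apply sin_incr_1; lra.
Qed.

Lemma sin_beta_bounds n : (1 <= n)%nat -> 0 < sin (beta n) < 1.
Proof.
  intros Hn; pose proof (beta_bounds n Hn); pose proof PI_RGT_0; split.
  - apply sin_gt_0; lra.
  - rewrite <- sin_PI2; apply sin_increasing_1; lra.
Qed.

Lemma cos_beta_pos n : (1 <= n)%nat -> 0 < cos (beta n).
Proof. intros Hn; pose proof (beta_bounds n Hn); apply cos_gt_0; lra. Qed.

Lemma sin_beta_dec n : (1 <= n)%nat -> sin (beta (S n)) < sin (beta n).
Proof.
  intros Hn; pose proof (beta_bounds n Hn); pose proof (beta_bounds (S n) ltac:(lia)).
  pose proof (beta_dec n Hn); apply sin_increasing_1; lra.
Qed.

Lemma half_turn_bounds k : (1 <= k)%nat -> 0 < (beta k - beta (S k)) / 2 < PI / 4.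
Proof.
  intros Hk; pose proof (beta_dec k Hk); pose proof (beta_bounds k Hk).
  pose proof (beta_bounds (S k) ltac:(lia)); lra.
Qed.

Lemma rad_pos k : (1 <= k)%nat -> 0 < rad k.
Proof.
  intros Hk; unfold rad; pose proof (half_turn_bounds k Hk).
  apply Rdiv_lt_0_compat; [apply sin_delta_pos; lia|]. apply tan_gt_0; lra.
Qed.

(* These identities put [ptS] and [ptT] on the circle with centre [(cenx, ceny)] and radius [rad]. *)
Lemma rad_chord k : (1 <= k)%nat ->
  rad k * (cos (beta k) - cos (beta (S k)))
    = - sin (delta (S k)) * (sin (beta k) + sin (beta (S k))) /\
  rad k * (sin (beta k) - sin (beta (S k)))
    = sin (delta (S k)) * (cos (beta k) + cos (beta (S k))).
Proof.
  intros Hk; pose proof (half_turn_bounds k Hk); pose proof PI_RGT_0.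
  rewrite form1, form2, form3, form4; unfold rad, tan.
  assert (0 < sin ((beta k - beta (S k)) / 2)) by (apply sin_gt_0; lra).
  assert (0 < cos ((beta k - beta (S k)) / 2)) by (apply cos_gt_0; lra).
  split; field; lra.
Qed.

Lemma ptA_beta n :
  ptA alpha n = (cos (delta n) * cos (beta n) - sin (delta n) * sin (beta n),
                 cos (delta n) * sin (beta n) + sin (delta n) * cos (beta n)).
Proof.
  unfold ptA. replace (alpha n) with (beta n + delta n) by (unfold beta, delta; lra).
  rewrite cos_plus, sin_plus; f_equal; ring.
Qed.

Lemma ptA_S_beta n :
  ptA alpha (S n) = (cos (delta n) * cos (beta n) + sin (delta n) * sin (beta n),
                     cos (delta n) * sin (beta n) - sin (delta n) * cos (beta n)).
Proof.
  unfold ptA. replace (alpha (S n)) with (beta n - delta n) by (unfold beta, delta; lra).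
  rewrite cos_minus, sin_minus; f_equal; ring.
Qed.

Lemma ptT_beta n : ptT alpha n = (cos (delta n) * cos (beta n), cos (delta n) * sin (beta n)).
Proof. unfold ptT; rewrite ptA_beta, ptA_S_beta; plane; f_equal; field. Qed.

Lemma ptT_onarc k : ptT alpha (S k) = onarc k (beta (S k)).
Proof. rewrite ptT_beta; unfold onarc, cenx, ceny; f_equal; ring. Qed.

Lemma ptS_beta k : (1 <= k)%nat ->
  ptS alpha (S k)
  = (cos (delta k) * cos (beta k) - (sin (delta (S k)) - sin (delta k)) * sin (beta k),
     cos (delta k) * sin (beta k) + (sin (delta (S k)) - sin (delta k)) * cos (beta k)).
Proof.
  intros Hk; unfold ptS; simpl pred; pose proof (sin_delta_pos k Hk).
  rewrite (ptA_beta k), (ptA_S_beta k).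
  replace ((alpha (S k) - alpha (S (S k))) / 2) with (delta (S k)) by reflexivity.
  set (m := Cmod _).
  assert (Hm : m = 2 * sin (delta k)).
  { unfold m, Cmod; plane; rewrite <- (sqrt_Rsqr (2 * sin (delta k))) by lra.
    f_equal; unfold Rsqr; pose proof (sin2_cos2 (beta k)) as E; unfold Rsqr in E.
    transitivity (4 * sin (delta k) * sin (delta k) *
      (sin (beta k) * sin (beta k) + cos (beta k) * cos (beta k))); [ring|rewrite E; ring]. }
  rewrite Hm; plane; f_equal; field; lra.
Qed.

Lemma ptS_onarc k : (1 <= k)%nat -> ptS alpha (S k) = onarc k (beta k).
Proof.
  intros Hk; rewrite ptS_beta by exact Hk; destruct (rad_chord k Hk) as [Hx Hy].
  (* The corner [ptA (S k)] is an endpoint of two edges; equating its two expressions links the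
     angles of index [k] with those of index [S k]. *)
  pose proof (ptA_S_beta k) as E; rewrite ptA_beta in E; injection E as Ex Ey.
  unfold onarc, cenx, ceny; f_equal; nra.
Qed.


(** * [J1] as an intersection of halfplanes *)

(* The point of the line through [ptA n] and [ptA (S n)] at signed distance [w] from [ptT n]. *)
Definition pt_line (n : nat) (w : R) : C :=
  (cos (delta n) * cos (beta n) - w * sin (beta n),
   cos (delta n) * sin (beta n) + w * cos (beta n)).

Lemma ptA_line n : ptA alpha n = pt_line n (sin (delta n)).
Proof. exact (ptA_beta n). Qed.

Lemma ptA_S_line n : ptA alpha (S n) = pt_line n (- sin (delta n)).
Proof. rewrite ptA_S_beta; unfold pt_line; f_equal; ring. Qed.

Lemma ptT_line n : ptT alpha n = pt_line n 0.
Proof. rewrite ptT_beta; unfold pt_line; f_equal; ring. Qed.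

Lemma ptS_line k : (1 <= k)%nat ->
  ptS alpha (S k) = pt_line k (sin (delta (S k)) - sin (delta k)).
Proof. exact (ptS_beta k). Qed.

(* Value at the normal angle [t] of the support function of the disc of the [k]-th arc. *)
Definition height (k : nat) (t : R) : R := cenx k * cos t + ceny k * sin t + rad k.

Lemma pt_line_dot n w t :
  dot (pt_line n w) (unit t) = cos (delta n) * cos (t - beta n) + w * sin (t - beta n).
Proof. rewrite cos_minus, sin_minus; unfold pt_line; plane; ring. Qed.

Lemma onarc_dot k s t : (1 <= k)%nat -> dot (onarc k s) (unit t) <= height k t.
Proof.
  intros Hk; unfold onarc, height; plane.
  pose proof (rad_pos k Hk); pose proof (COS_bound (s - t)) as [_ Hc]; rewrite cos_minus in Hc.
  nra.
Qed.

Lemma sin_nonpos_near t : - PI <= t <= 0 -> sin t <= 0.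
Proof. intros Ht; pose proof (sin_ge_0 (- t) ltac:(lra) ltac:(lra)) as H; rewrite sin_neg in H; lra. Qed.

Lemma beta_mono m n : (1 <= m <= n)%nat -> beta n <= beta m.
Proof.
  intros H; unfold beta; pose proof (alpha_mono m n H).
  pose proof (alpha_mono (S m) (S n) ltac:(lia)); lra.
Qed.

Definition arc_angle (k : nat) (t : R) : Prop := (1 <= k)%nat /\ beta (S k) <= t <= beta k.

Lemma arc_angle_bounds k t : arc_angle k t -> 0 < t < PI / 2.
Proof.
  intros [Hk Ht]; pose proof (beta_bounds k Hk); pose proof (beta_bounds (S k) ltac:(lia)); lra.
Qed.

(** Along edge [n] the functional is affine in [w] with slope [sin (t - beta n)]. It increases on
    edge [S k] up to [ptT (S k)] and decreases on edge [k] from [ptS (S k)] on; both tangency points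
    lie on the disc. *)
Lemma height_ge_line k t : arc_angle k t ->
  (forall w, w <= 0 -> dot (pt_line (S k) w) (unit t) <= height k t) /\
  (forall w, sin (delta (S k)) - sin (delta k) <= w -> dot (pt_line k w) (unit t) <= height k t).
Proof.
  intros Ht; pose proof (arc_angle_bounds k t Ht) as Hb; destruct Ht as [Hk Ht].
  pose proof (beta_bounds k Hk); pose proof (beta_bounds (S k) ltac:(lia)).
  split; intros w Hw; rewrite pt_line_dot.
  - pose proof (onarc_dot k (beta (S k)) t Hk) as H1.
    rewrite <- ptT_onarc, ptT_line, pt_line_dot in H1.
    pose proof (sin_ge_0 (t - beta (S k)) ltac:(lra) ltac:(lra)); nra.
  - pose proof (onarc_dot k (beta k) t Hk) as H1.
    rewrite <- ptS_onarc, ptS_line, pt_line_dot in H1 by exact Hk.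
    pose proof (sin_nonpos_near (t - beta k) ltac:(lra)); nra.
Qed.

(** On the unit circle the functional is cos(t - a), monotone on each side of [t], so the extreme
    cases are the neighbouring corners [ptA (S (S k))] and [ptA k], which lie on the two tangent
    edges. *)
Lemma height_ge_unit k t a : arc_angle k t ->
  0 <= a <= alpha (S (S k)) \/ alpha k <= a <= PI / 2 -> dot (unit a) (unit t) <= height k t.
Proof.
  intros Ht Ha; pose proof (arc_angle_bounds k t Ht) as Hb; destruct (height_ge_line k t Ht) as [H1 H2].
  destruct Ht as [Hk Ht].
  pose proof (sin_delta_pos k Hk); pose proof (sin_delta_pos (S k) ltac:(lia)).
  assert (E : forall s, dot (unit s) (unit t) = cos (t - s)) by (intros s; plane; rewrite cos_minus; ring).
  pose proof (alpha_dec k Hk); pose proof (alpha_dec (S k) ltac:(lia)).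
  pose proof (alpha_pos (S (S k)) ltac:(lia)).
  assert (beta k <= alpha k) by (unfold beta; lra).
  assert (alpha (S (S k)) <= beta (S k)) by (unfold beta; lra).
  destruct Ha as [Ha|Ha].
  - apply Rle_trans with (dot (unit (alpha (S (S k)))) (unit t)).
    + rewrite !E; apply cos_decr_1; lra.
    + change (unit (alpha (S (S k)))) with (ptA alpha (S (S k))); rewrite ptA_S_line; apply H1; lra.
  - apply Rle_trans with (dot (unit (alpha k)) (unit t)).
    + rewrite !E, <- (cos_neg (t - a)), <- (cos_neg (t - alpha k)); apply cos_decr_1; lra.
    + change (unit (alpha k)) with (ptA alpha k); rewrite ptA_line; apply H2.
      pose proof (sin_delta_dec k Hk); lra.
Qed.

(** On an edge not adjacent to the corner the worse endpoint decides, and it is on the unit circle.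
    The two implications exclude the pieces of the adjacent edges that the arc cuts off. *)
Lemma pt_line_dot_le_height n w k t : arc_angle k t -> (1 <= n)%nat ->
  - sin (delta n) <= w <= sin (delta n) ->
  (n = k -> sin (delta (S k)) - sin (delta k) <= w) -> (n = S k -> w <= 0) ->
  dot (pt_line n w) (unit t) <= height k t.
Proof.
  intros Ht Hn Hw Hnk HnS; pose proof (arc_angle_bounds k t Ht) as Hb.
  destruct (height_ge_line k t Ht) as [H1 H2].
  destruct (Nat.eq_dec n k) as [->|Hk]; [apply H2; auto|].
  destruct (Nat.eq_dec n (S k)) as [->|HS]; [apply H1; auto|].
  pose proof (beta_bounds n Hn).
  destruct (Nat.lt_ge_cases n k) as [Hlt|Hge].
  - apply Rle_trans with (dot (pt_line n (- sin (delta n))) (unit t)).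
    + rewrite !pt_line_dot; pose proof (beta_mono n k ltac:(lia)); destruct Ht as [_ Ht].
      pose proof (sin_nonpos_near (t - beta n) ltac:(lra)); nra.
    + rewrite <- ptA_S_line; apply height_ge_unit; [exact Ht|right].
      split; [apply alpha_mono; lia|apply alpha_le; lia].
  - apply Rle_trans with (dot (pt_line n (sin (delta n))) (unit t)).
    + destruct Ht as [Hk1 Ht].
      rewrite !pt_line_dot; pose proof (beta_mono (S k) n ltac:(lia)).
      pose proof (sin_ge_0 (t - beta n) ltac:(lra) ltac:(lra)); nra.
    + rewrite <- ptA_line; apply height_ge_unit; [exact Ht|left].
      pose proof (alpha_pos n Hn); split; [lra|destruct Ht; apply alpha_mono; lia].
Qed.

(** The arc angles fill only the interval from 0, excluded, to [beta 1]; the box supplies the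
    limiting tangent [Re z <= 1], the bound at the top, and the coordinate axes. *)
Definition region (z : C) : Prop :=
  0 <= Re z <= 1 /\ 0 <= Im z <= 1 /\
  forall k t, arc_angle k t -> dot z (unit t) <= height k t.

Lemma convex_halfplane (v : C) (h : R) : convex (fun z => dot z v <= h).
Proof.
  intros [px py] [qx qy] z Hp Hq [t [Ht ->]]; destruct v as [vx vy]; revert Hp Hq; plane; nra.
Qed.

Lemma convex_box : convex (fun z => 0 <= Re z <= 1 /\ 0 <= Im z <= 1).
Proof.
  intros [px py] [qx qy] z Hp Hq [t [Ht ->]]; revert Hp Hq; plane; intros Hp Hq.
  split; split; nra.
Qed.

Lemma convex_region : convex region.
Proof.
  intros p q z (Hp1 & Hp2 & Hp) (Hq1 & Hq2 & Hq) Hz.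
  destruct (convex_box p q z (conj Hp1 Hp2) (conj Hq1 Hq2) Hz) as [H1 H2].
  split; [exact H1|split; [exact H2|]]; intros k t Ht.
  apply (convex_halfplane (unit t) (height k t) p q z); auto.
Qed.

Lemma triangle_in_convex (D : C -> Prop) (p q s z : C) :
  convex D -> D p -> D q -> D s -> triangle p q s z -> D z.
Proof. intros HD Hp Hq Hs Hz; apply Hz; [exact HD|]; intros w [->|[->| ->]]; assumption. Qed.

Lemma unit_box a : 0 <= a <= PI / 2 -> 0 <= Re (unit a) <= 1 /\ 0 <= Im (unit a) <= 1.
Proof.
  intros Ha; plane; pose proof (COS_bound a); pose proof (SIN_bound a).
  pose proof (cos_ge_0 a ltac:(lra) ltac:(lra)); pose proof (sin_ge_0 a ltac:(lra) ltac:(lra)); lra.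
Qed.

Lemma pt_line_box n w : (1 <= n)%nat -> - sin (delta n) <= w <= sin (delta n) ->
  0 <= Re (pt_line n w) <= 1 /\ 0 <= Im (pt_line n w) <= 1.
Proof.
  intros Hn Hw.
  pose proof (alpha_pos n Hn); pose proof (alpha_le n Hn).
  pose proof (unit_box (alpha n) ltac:(lra)) as Hb.
  pose proof (alpha_pos (S n) ltac:(lia)); pose proof (alpha_le (S n) ltac:(lia)).
  pose proof (unit_box (alpha (S n)) ltac:(lra)) as HbS.
  change (unit (alpha n)) with (ptA alpha n) in Hb; rewrite ptA_line in Hb.
  change (unit (alpha (S n))) with (ptA alpha (S n)) in HbS; rewrite ptA_S_line in HbS.
  revert Hb HbS; unfold pt_line; plane.
  pose proof (sin_beta_bounds n Hn); pose proof (cos_beta_pos n Hn); intros; split; split; nra.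
Qed.

Lemma region_pt_line n w : (1 <= n)%nat ->
  sin (delta (S n)) - sin (delta n) <= w <= sin (delta n) -> ((2 <= n)%nat -> w <= 0) ->
  region (pt_line n w).
Proof.
  intros Hn Hw Hn2; pose proof (sin_delta_pos (S n) ltac:(lia)).
  destruct (pt_line_box n w Hn ltac:(lra)) as [H1 H2].
  split; [exact H1|split; [exact H2|]]; intros k t Ht.
  apply pt_line_dot_le_height; auto; [lra| |].
  - intros ->; lra.
  - intros ->; apply Hn2; destruct Ht; lia.
Qed.

Lemma cos_delta_pos n : (1 <= n)%nat -> 0 < cos (delta n).
Proof. intros Hn; pose proof (delta_bounds n Hn); apply cos_gt_0; lra. Qed.

Lemma region_0 : region (RtoC 0).
Proof.
  split; [plane; lra|split; [plane; lra|]]; intros k t Ht.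
  pose proof (proj1 (height_ge_line k t Ht) 0 ltac:(lra)) as H; apply Rle_trans with (2 := H).
  rewrite pt_line_dot; plane; pose proof (arc_angle_bounds k t Ht); destruct Ht as [Hk Ht].
  pose proof (beta_bounds (S k) ltac:(lia)); pose proof (cos_delta_pos (S k) ltac:(lia)).
  pose proof (cos_ge_0 (t - beta (S k)) ltac:(lra) ltac:(lra)); nra.
Qed.

Lemma region_1 : region (RtoC 1).
Proof.
  split; [plane; lra|split; [plane; lra|]]; intros k t Ht.
  replace (RtoC 1) with (unit 0) by (unfold unit; rewrite cos_0, sin_0; reflexivity).
  apply height_ge_unit; [exact Ht|left].
  pose proof (alpha_pos (S (S k)) ltac:(lia)); lra.
Qed.

Lemma disc_dot k (z : C) t :
  Cmod (z - (cenx k, ceny k))%C = rad k -> dot z (unit t) <= height k t.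
Proof.
  intros Hz; destruct z as [x y]; pose proof (Cmod_ge_0 ((x, y) - (cenx k, ceny k))%C) as H0.
  assert (Hsq : (x - cenx k) ^ 2 + (y - ceny k) ^ 2 = rad k ^ 2).
  { rewrite <- Hz, Cmod_pow2; plane; ring. }
  rewrite Hz in H0.
  pose proof (sin2_cos2 t) as E; unfold Rsqr in E; unfold height; plane.
  set (a := x - cenx k) in *; set (b := y - ceny k) in *.
  replace x with (cenx k + a) by (unfold a; ring); replace y with (ceny k + b) by (unfold b; ring).
  assert (a * cos t + b * sin t <= rad k); [|lra].
  apply Rsqr_incr_0_var; [|exact H0]; unfold Rsqr.
  replace (rad k * rad k) with ((a * a + b * b) * (sin t * sin t + cos t * cos t)) by (rewrite E; lra).
  pose proof (Rle_0_sqr (a * sin t - b * cos t)) as Hs; unfold Rsqr in Hs; lra.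
Qed.

Lemma Cmod_onarc k t : (1 <= k)%nat -> Cmod (onarc k t - (cenx k, ceny k))%C = rad k.
Proof.
  intros Hk; pose proof (rad_pos k Hk); unfold onarc, Cmod; plane.
  transitivity (sqrt (Rsqr (rad k))); [f_equal|apply sqrt_Rsqr; lra].
  pose proof (sin2_cos2 t) as E; unfold Rsqr in *.
  transitivity (rad k * rad k * (sin t * sin t + cos t * cos t)); [ring|rewrite E; ring].
Qed.

Lemma ptA_sub_ptS k : (1 <= k)%nat ->
  (ptA alpha (S k) - ptS alpha (S k))%C
  = (sin (delta (S k)) * sin (beta k), - (sin (delta (S k)) * cos (beta k))).
Proof. intros Hk; rewrite (ptA_S_line k), ptS_line by exact Hk; unfold pt_line; plane; f_equal; ring. Qed.

Lemma ptA_sub_ptT k :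
  (ptA alpha (S k) - ptT alpha (S k))%C
  = (- (sin (delta (S k)) * sin (beta (S k))), sin (delta (S k)) * cos (beta (S k))).
Proof. rewrite (ptA_line (S k)), ptT_line; unfold pt_line; plane; f_equal; ring. Qed.

(** Orthogonality puts the centre on the normals to both edges at the tangency points. These lines
    meet only at [(cenx k, ceny k)], their determinant being [sin (beta k - beta (S k))]. *)
Lemma tangent_circle_corner k c r : (1 <= k)%nat ->
  tangent_circle (ptS alpha (S k)) (ptA alpha (S k)) (ptT alpha (S k)) c r ->
  c = (cenx k, ceny k) /\ r = rad k.
Proof.
  intros Hk (Hr & Hs & Ht & Hds & Hdt); destruct c as [cx cy].
  assert (H0 : 0 < sin (delta (S k))) by (apply sin_delta_pos; lia).
  assert (Hrk := rad_pos k Hk).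
  assert (E1 : (cx - cenx k) * sin (beta k) = (cy - ceny k) * cos (beta k)).
  { rewrite ptA_sub_ptS, ptS_onarc in Hds by exact Hk; revert Hds; unfold onarc; plane; intros Hds.
    apply (Rmult_eq_reg_l (sin (delta (S k)))); lra. }
  assert (E2 : (cx - cenx k) * sin (beta (S k)) = (cy - ceny k) * cos (beta (S k))).
  { rewrite ptA_sub_ptT, ptT_onarc in Hdt; revert Hdt; unfold onarc; plane; intros Hdt.
    apply (Rmult_eq_reg_l (sin (delta (S k)))); lra. }
  assert (Hd : 0 < sin (beta k - beta (S k))).
  { pose proof (half_turn_bounds k Hk); apply sin_gt_0; lra. }
  rewrite sin_minus in Hd.
  assert (Hx : cx - cenx k = 0).
  { apply (Rmult_eq_reg_r (sin (beta k) * cos (beta (S k)) - cos (beta k) * sin (beta (S k)))); [|lra].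
    transitivity ((cx - cenx k) * sin (beta k) * cos (beta (S k))
                  - cos (beta k) * ((cx - cenx k) * sin (beta (S k)))); [ring|rewrite E1, E2; ring]. }
  assert (Hy : cy - ceny k = 0).
  { apply (Rmult_eq_reg_r (sin (beta k) * cos (beta (S k)) - cos (beta k) * sin (beta (S k)))); [|lra].
    transitivity (sin (beta k) * ((cy - ceny k) * cos (beta (S k)))
                  - (cy - ceny k) * cos (beta k) * sin (beta (S k))); [ring|rewrite <- E1, <- E2; ring]. }
  assert (Ec : (cx, cy) = (cenx k, ceny k)) by (f_equal; lra).
  split; [exact Ec|]; rewrite <- Ht, Ec, ptT_onarc; apply Cmod_onarc; exact Hk.
Qed.

(** The halfplanes of the arc's own corner contain its whole circle; those of any other corner
    already contain the three vertices of the triangle. *)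
Lemma arc_in_region n z : (2 <= n)%nat -> arc alpha n z -> region z.
Proof.
  intros Hn [Htri [c [r [Hc Hz]]]]; destruct n as [|k]; [lia|].
  assert (Hk : (1 <= k)%nat) by lia.
  destruct (tangent_circle_corner k c r Hk Hc) as [-> ->].
  pose proof (sin_delta_pos k Hk); pose proof (sin_delta_pos (S k) ltac:(lia)).
  pose proof (sin_delta_dec k Hk); pose proof (sin_delta_dec (S k) ltac:(lia)).
  rewrite ptS_line, ptA_line, ptT_line in Htri by exact Hk.
  assert (Hbox : 0 <= Re z <= 1 /\ 0 <= Im z <= 1).
  { apply (triangle_in_convex _ _ _ _ z convex_box) with (4 := Htri); apply pt_line_box; lia || lra. }
  split; [apply Hbox|split; [apply Hbox|]]; intros j t Ht.
  destruct (Nat.eq_dec j k) as [->|Hj]; [apply disc_dot; exact Hz|].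
  apply (triangle_in_convex _ _ _ _ z (convex_halfplane (unit t) (height j t))) with (4 := Htri);
    apply pt_line_dot_le_height; lia || lra || auto; intros E; subst; lia || lra.
Qed.

Lemma J1_region z : J1 alpha z -> region z.
Proof.
  intros Hz; apply Hz; [exact convex_region|].
  intros w [->|[->|[(n & Hn & Hw)|[Hw|(n & Hn & Hw)]]]].
  - exact region_0.
  - exact region_1.
  - exact (arc_in_region n w Hn Hw).
  - pose proof (sin_delta_pos 1 ltac:(lia)); pose proof (sin_delta_dec 1 ltac:(lia)).
    pose proof (sin_delta_pos 2 ltac:(lia)).
    rewrite ptA_line, ptS_line in Hw by lia.
    apply (convex_region _ _ _) with (3 := Hw); apply region_pt_line; lia || lra.
  - pose proof (sin_delta_pos n ltac:(lia)); pose proof (sin_delta_dec n ltac:(lia)).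
    pose proof (sin_delta_pos (S n) ltac:(lia)).
    rewrite ptT_line, ptS_line in Hw by lia.
    apply (convex_region _ _ _) with (3 := Hw); apply region_pt_line; lia || lra.
Qed.

Lemma tangent_circle_exists k : (1 <= k)%nat ->
  tangent_circle (ptS alpha (S k)) (ptA alpha (S k)) (ptT alpha (S k)) (cenx k, ceny k) (rad k).
Proof.
  intros Hk; split; [apply rad_pos; exact Hk|].
  rewrite ptA_sub_ptS, ptA_sub_ptT, ptS_onarc, ptT_onarc by exact Hk.
  repeat split; try (apply Cmod_onarc; exact Hk); unfold onarc; plane; ring.
Qed.

(* In the frame of the bisector of the corner, with [g] half the turning angle and [s] the
   angle to the bisector, the barycentric coordinates of the point of the arc are explicit. *)
Lemma arc_barycentric g s : 0 < g < PI / 2 -> - g <= s <= g ->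
  exists a b c, 0 <= a /\ 0 <= b /\ 0 <= c /\ a + b + c = 1 /\
    a / cos g + (b + c) * cos g = cos s /\ (b - c) * sin g = sin s.
Proof.
  intros Hg Hs; pose proof PI_RGT_0.
  assert (Hsg : 0 < sin g) by (apply sin_gt_0; lra).
  assert (Hcg : 0 < cos g) by (apply cos_gt_0; lra).
  pose proof (sin2_cos2 g) as E; unfold Rsqr in E.
  assert (Hcs : cos g <= cos s).
  { destruct (Rle_dec 0 s); [apply cos_decr_1; lra|rewrite <- (cos_neg s); apply cos_decr_1; lra]. }
  pose proof (COS_bound (g - s)) as [_ H1]; rewrite cos_minus in H1.
  pose proof (COS_bound (g + s)) as [_ H2]; rewrite cos_plus in H2.
  (* The apex weight solves the first frame equation with b + c = 1 - a. The other two weights then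
     equal (1 - cos(g + s)) and (1 - cos(g - s)), each divided by 2 sin(g)^2, hence are
     nonnegative. *)
  set (a := cos g * (cos s - cos g) / (sin g * sin g)).
  assert (Ha : 1 - a = (1 - cos g * cos s) / (sin g * sin g)).
  { transitivity ((sin g * sin g + cos g * cos g - cos g * cos s) / (sin g * sin g));
      [unfold a; field; lra|rewrite E; reflexivity]. }
  assert (Hd : 0 < sin g * sin g) by nra.
  exists a, ((1 - a + sin s / sin g) / 2), ((1 - a - sin s / sin g) / 2).
  assert (P : 0 <= 1 - a + sin s / sin g /\ 0 <= 1 - a - sin s / sin g).
  { rewrite Ha; split.
    - replace (_ + _) with ((1 - cos g * cos s + sin g * sin s) / (sin g * sin g)) by (field; lra).
      apply Rdiv_le_0_compat; lra.
    - replace (_ - _) with ((1 - cos g * cos s - sin g * sin s) / (sin g * sin g)) by (field; lra).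
      apply Rdiv_le_0_compat; lra. }
  repeat split; try lra.
  - unfold a; apply Rdiv_le_0_compat; nra.
  - replace (_ + _) with (a / cos g + (1 - a) * cos g) by (field; lra); rewrite Ha; unfold a.
    assert (Ec : cos g * cos g = 1 - sin g * sin g) by lra.
    field_simplify_eq; [|lra]; nra.
  - field; lra.
Qed.

Lemma arc_onarc k t : arc_angle k t -> arc alpha (S k) (onarc k t).
Proof.
  intros [Hk Ht]; pose proof PI_RGT_0; split.
  - pose proof (half_turn_bounds k Hk) as Hg; set (g := (beta k - beta (S k)) / 2) in *.
    set (m := (beta k + beta (S k)) / 2).
    assert (Eb : beta k = m + g) by (unfold m, g; lra).
    assert (EbS : beta (S k) = m - g) by (unfold m, g; lra).
    destruct (arc_barycentric g (t - m)) as (a & b & c & Ha & Hb & Hc & Hs & E1 & E2); [lra|lra|].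
    assert (Hcg : 0 < cos g) by (apply cos_gt_0; lra).
    assert (Hsg : 0 < sin g) by (apply sin_gt_0; lra).
    pose proof (triangle_barycentric (ptS alpha (S k)) (ptA alpha (S k)) (ptT alpha (S k)) b a c
      Hb Ha Hc ltac:(lra)) as Htri.
    replace (onarc k t) with (b * ptS alpha (S k) + a * ptA alpha (S k) + c * ptT alpha (S k))%C; [exact Htri|].
    (* The corner lies on the bisector direction [m] at distance [rad k / cos g] from the centre. *)
    assert (HA : ptA alpha (S k)
      = (cenx k + rad k / cos g * cos m, ceny k + rad k / cos g * sin m)).
    { replace (ptA alpha (S k)) with (ptT alpha (S k) + (ptA alpha (S k) - ptT alpha (S k)))%C by ring.
      rewrite ptA_sub_ptT, ptT_onarc; unfold onarc; plane.
      assert (Hr : rad k * sin g = sin (delta (S k)) * cos g).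
      { unfold rad, tan; fold g; field; lra. }
      rewrite EbS, cos_minus, sin_minus.
      assert (Hd : sin (delta (S k)) = rad k * sin g / cos g) by (rewrite Hr; field; lra).
      pose proof (sin2_cos2 g) as E; unfold Rsqr in E.
      rewrite Hd; f_equal.
      - transitivity (cenx k + rad k / cos g * cos m * (sin g * sin g + cos g * cos g)); [field; lra|rewrite E; ring].
      - transitivity (ceny k + rad k / cos g * sin m * (sin g * sin g + cos g * cos g)); [field; lra|rewrite E; ring]. }
    rewrite HA, ptS_onarc, ptT_onarc by exact Hk; unfold onarc.
    rewrite Eb, EbS, !cos_minus, !cos_plus, !sin_minus, !sin_plus.
    replace t with (m + (t - m)) by ring; rewrite cos_plus, sin_plus, <- E1, <- E2.
    plane; f_equal; replace b with (1 - a - c) by lra; field; lra.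
  - exists (cenx k, ceny k), (rad k); split; [exact (tangent_circle_exists k Hk)|].
    apply Cmod_onarc; exact Hk.
Qed.

(** * The outer normal as a function of the height *)

Definition yT (n : nat) : R := cos (delta n) * sin (beta n).
(** Height of [ptS (S k)]: the index is that of the arc, whereas [yT k] is the height of [ptT k]. *)
Definition yS (k : nat) : R := ceny k + rad k * sin (beta k).

Lemma yT_corner k : yT (S k) = ceny k + rad k * sin (beta (S k)).
Proof. unfold yT, ceny; ring. Qed.

Lemma yS_line k : (1 <= k)%nat ->
  yS k = yT k + (sin (delta (S k)) - sin (delta k)) * cos (beta k).
Proof.
  intros Hk; pose proof (ptS_line k Hk) as E; rewrite ptS_onarc in E by exact Hk.
  injection E as _ E; exact E.
Qed.

Lemma yT_lt_yS k : (1 <= k)%nat -> yT (S k) < yS k.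
Proof.
  intros Hk; rewrite yT_corner; unfold yS.
  pose proof (rad_pos k Hk); pose proof (sin_beta_dec k Hk); nra.
Qed.

Lemma yS_le_yT k : (1 <= k)%nat -> yS k <= yT k.
Proof.
  intros Hk; rewrite yS_line by exact Hk.
  pose proof (sin_delta_dec k Hk); pose proof (cos_beta_pos k Hk); nra.
Qed.

Lemma yT_pos n : (1 <= n)%nat -> 0 < yT n.
Proof.
  intros Hn; apply Rmult_lt_0_compat; [apply cos_delta_pos|apply sin_beta_bounds]; exact Hn.
Qed.

Lemma yT_mono m n : (1 <= m <= n)%nat -> yT n <= yT m.
Proof.
  intros [Hm Hn]; induction Hn as [|n Hn IH]; [lra|].
  pose proof (yT_lt_yS n ltac:(lia)); pose proof (yS_le_yT n ltac:(lia)); lra.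
Qed.

Lemma yT_le_beta n : (1 <= n)%nat -> yT n <= beta n.
Proof.
  intros Hn; pose proof (beta_bounds n Hn); pose proof (sin_lt_x (beta n) ltac:(lra)).
  pose proof (sin_beta_bounds n Hn); pose proof (cos_delta_pos n Hn).
  pose proof (COS_bound (delta n)); unfold yT; nra.
Qed.

(* The arc of boundary from [ptT (S k)] to [ptT k]; for [k = 1] it goes up to [ptA 1], the
   topmost point of the set. *)
Definition zone_end (k : nat) : R := match k with 1%nat => sin (delta 1) | _ => 0 end.
Definition ztop (k : nat) : R := Im (pt_line k (zone_end k)).
Definition zone (k : nat) (y : R) : Prop := (1 <= k)%nat /\ yT (S k) < y <= ztop k.

(* Sine of the angle between the outer normal at height [y] and the real axis. *)
Definition zone_sine (k : nat) (y : R) : R :=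
  Rmax (sin (beta (S k))) (Rmin (sin (beta k)) ((y - ceny k) / rad k)).

Lemma zone_end_nonneg k : 0 <= zone_end k.
Proof. destruct k as [|[|k]]; simpl; try lra; apply Rlt_le, sin_delta_pos; lia. Qed.

Lemma yT_le_ztop k : (1 <= k)%nat -> yT k <= ztop k.
Proof.
  intros Hk; unfold ztop, pt_line, yT; simpl.
  pose proof (zone_end_nonneg k); pose proof (cos_beta_pos k Hk); nra.
Qed.

Lemma ztop_1 : ztop 1 = 1.
Proof.
  unfold ztop; simpl zone_end; rewrite <- ptA_line; unfold ptA; simpl.
  destruct Halpha as [-> _]; apply sin_PI2.
Qed.

Lemma ztop_SS k : ztop (S (S k)) = yT (S (S k)).
Proof. unfold ztop, yT, pt_line; simpl; ring. Qed.

Lemma zone_pos k y : zone k y -> 0 < y.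
Proof. intros [Hk Hy]; pose proof (yT_pos (S k) ltac:(lia)); lra. Qed.

Lemma zone_le j k y z : zone k y -> zone j z -> y <= z -> (j <= k)%nat.
Proof.
  intros [Hk Hy] [Hj Hz] Hyz; destruct (Nat.le_gt_cases j k) as [H|H]; [exact H|exfalso].
  destruct j as [|[|j]]; [lia|lia|]; rewrite ztop_SS in Hz.
  pose proof (yT_mono (S k) (S (S j)) ltac:(lia)); lra.
Qed.

Lemma zone_yT n : (2 <= n)%nat -> zone n (yT n).
Proof.
  intros Hn; split; [lia|]; pose proof (yT_lt_yS n ltac:(lia)); pose proof (yS_le_yT n ltac:(lia)).
  pose proof (yT_le_ztop n ltac:(lia)); lra.
Qed.

Lemma zone_yS k : (1 <= k)%nat -> zone k (yS k).
Proof.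
  intros Hk; split; [exact Hk|]; pose proof (yT_lt_yS k Hk); pose proof (yS_le_yT k Hk).
  pose proof (yT_le_ztop k Hk); lra.
Qed.

Lemma zone_le_1 k y : zone k y -> y <= 1.
Proof.
  intros [Hk Hy]; destruct k as [|[|k]]; [lia|rewrite ztop_1 in Hy; lra|].
  rewrite ztop_SS in Hy; pose proof (yT_mono 1 (S (S k)) ltac:(lia)).
  pose proof (yT_le_ztop 1 ltac:(lia)); rewrite ztop_1 in *; lra.
Qed.

(** The heights [yT] tend to 0, so some index lies below [y]; descending from it finds the first
    crossing. *)
Lemma zone_exists y : 0 < y <= 1 -> exists k, zone k y.
Proof.
  intros Hy.
  assert (Hsmall : exists n, yT (S n) < y).
  { destruct (proj2 (is_lim_seq_spec _ _) beta_lim (mkposreal y (proj1 Hy))) as [n Hn].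
    exists n; specialize (Hn (S n) ltac:(lia)); simpl in Hn.
    pose proof (yT_le_beta (S n) ltac:(lia)); apply Rabs_def2 in Hn; lra. }
  destruct Hsmall as [n Hn]; revert Hn; induction n as [|n IH]; intros Hn.
  - exists 1%nat; split; [lia|]; rewrite ztop_1; split; [|lra].
    pose proof (yT_mono 1 2 ltac:(lia)); lra.
  - destruct (Rlt_dec (yT (S n)) y) as [H|H]; [exact (IH H)|].
    exists (S n); split; [lia|]; pose proof (yT_le_ztop (S n) ltac:(lia)); lra.
Qed.

Lemma zone_sine_bounds k y : (1 <= k)%nat -> sin (beta (S k)) <= zone_sine k y <= sin (beta k).
Proof.
  intros Hk; split; [apply Rmax_l|]; apply Rmax_lub; [|apply Rmin_l].
  apply Rlt_le, sin_beta_dec; exact Hk.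
Qed.

Lemma zone_sine_low k y : (1 <= k)%nat -> y <= yT (S k) -> zone_sine k y = sin (beta (S k)).
Proof.
  intros Hk Hy; rewrite yT_corner in Hy; apply Rmax_left; pose proof (rad_pos k Hk).
  apply Rle_trans with (1 := Rmin_r _ _).
  apply (Rmult_le_reg_r (rad k)); [lra|]; unfold Rdiv; rewrite Rmult_assoc, Rinv_l; lra.
Qed.

Lemma zone_sine_mid k y : (1 <= k)%nat -> yT (S k) <= y <= yS k ->
  zone_sine k y = (y - ceny k) / rad k.
Proof.
  intros Hk [Hy1 Hy2]; rewrite yT_corner in Hy1; unfold yS in Hy2; pose proof (rad_pos k Hk).
  unfold zone_sine; rewrite Rmin_right, Rmax_right; [reflexivity| |];
  apply (Rmult_le_reg_r (rad k)); try lra; unfold Rdiv; rewrite Rmult_assoc, Rinv_l; lra.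
Qed.

Lemma zone_sine_high k y : (1 <= k)%nat -> yS k <= y -> zone_sine k y = sin (beta k).
Proof.
  intros Hk Hy; unfold yS in Hy; pose proof (rad_pos k Hk); unfold zone_sine.
  rewrite Rmin_left; [apply Rmax_right, Rlt_le, sin_beta_dec; exact Hk|].
  apply (Rmult_le_reg_r (rad k)); try lra; unfold Rdiv; rewrite Rmult_assoc, Rinv_l; lra.
Qed.

Lemma zone_sine_lipschitz k y z : (1 <= k)%nat -> y <= z ->
  zone_sine k y <= zone_sine k z <= zone_sine k y + (z - y) / rad k.
Proof.
  intros Hk Hyz; pose proof (rad_pos k Hk); unfold zone_sine.
  assert (H0 : 0 <= (z - y) / rad k) by (apply Rdiv_le_0_compat; lra).
  replace ((z - ceny k) / rad k) with ((y - ceny k) / rad k + (z - y) / rad k) by (field; lra).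
  unfold Rmax, Rmin; repeat destruct Rle_dec; lra.
Qed.

Lemma J1_zone_segment k w : (1 <= k)%nat ->
  sin (delta (S k)) - sin (delta k) <= w <= zone_end k -> J1 alpha (pt_line k w).
Proof.
  intros Hk Hw.
  assert (Hseg : segment (pt_line k (zone_end k)) (ptS alpha (S k)) (pt_line k w)).
  { rewrite ptS_line by exact Hk; pose proof (zone_end_nonneg k) as H0.
    set (w1 := zone_end k) in *; set (w0 := sin (delta (S k)) - sin (delta k)) in *.
    (* When [ptS (S k)] coincides with [ptT k] the segment degenerates to a point. *)
    destruct (Req_dec w0 w1) as [E|E].
    - replace w with w1 by lra; apply segment_l.
    - exists ((w1 - w) / (w1 - w0)); split.
      + split; [apply Rdiv_le_0_compat; lra|].
        apply (Rmult_le_reg_r (w1 - w0)); [lra|]; unfold Rdiv; rewrite Rmult_assoc, Rinv_l; lra.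
      + unfold pt_line; plane; f_equal; field; lra. }
  apply convex_hull_incl; right; right; right.
  destruct k as [|[|k]]; [lia| |].
  - left; simpl zone_end in Hseg; rewrite <- ptA_line in Hseg; exact Hseg.
  - right; exists (S (S k)); split; [lia|].
    simpl zone_end in Hseg; rewrite <- ptT_line in Hseg; exact Hseg.
Qed.

Lemma height_beta k : (1 <= k)%nat -> height k (beta k) = cos (delta k).
Proof.
  intros Hk; pose proof (pt_line_dot k (sin (delta (S k)) - sin (delta k)) (beta k)) as E.
  rewrite <- ptS_line, ptS_onarc, Rminus_diag, cos_0, sin_0 in E by exact Hk.
  transitivity (dot (onarc k (beta k)) (unit (beta k))); [|rewrite E; ring].
  pose proof (sin2_cos2 (beta k)) as E2; unfold Rsqr in E2.
  unfold height, onarc; plane.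
  transitivity (cenx k * cos (beta k) + ceny k * sin (beta k)
    + rad k * (sin (beta k) * sin (beta k) + cos (beta k) * cos (beta k)));
    [rewrite E2; ring|ring].
Qed.

(** The halfplane at the boundary point of height [y], divided by the positive cosine of its normal
    angle, bounds [Re z]. Up to [yS k] the point is on the arc; above, it is on the edge with normal
    angle [beta k]. *)
Lemma zone_support k y : zone k y ->
  exists x, J1 alpha (x, y) /\
    forall z, region z -> Re z <= x - tan (asin (zone_sine k y)) * (Im z - y).
Proof.
  intros [Hk Hy]; pose proof (rad_pos k Hk) as Hr; pose proof PI_RGT_0.
  pose proof (beta_bounds k Hk); pose proof (beta_bounds (S k) ltac:(lia)).
  pose proof (beta_dec k Hk).
  destruct (Rle_dec y (yS k)) as [Hle|Hgt].
  - rewrite zone_sine_mid by (exact Hk || lra).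
    pose proof (zone_sine_bounds k y Hk) as Hb; rewrite zone_sine_mid in Hb by (exact Hk || lra).
    set (s := (y - ceny k) / rad k) in *; set (t := asin s).
    pose proof (sin_beta_bounds k Hk); pose proof (sin_beta_bounds (S k) ltac:(lia)).
    assert (Hst : sin t = s) by (apply sin_asin; lra).
    assert (Htb := asin_bound s : - (PI / 2) <= t <= PI / 2).
    assert (Ht : arc_angle k t) by (split; [exact Hk|split; apply sin_incr_0; lra]).
    assert (Hyt : y = ceny k + rad k * sin t) by (rewrite Hst; unfold s; field; lra).
    exists (cenx k + rad k * cos t); split.
    + apply convex_hull_incl; right; right; left; exists (S k); split; [lia|].
      rewrite Hyt; apply arc_onarc; exact Ht.
    + intros z (_ & _ & Hz); specialize (Hz k t Ht); revert Hz; unfold height; plane; intros Hz.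
      pose proof (arc_angle_bounds k t Ht) as Hb2.
      assert (Hc : 0 < cos t) by (apply cos_gt_0; lra).
      pose proof (sin2_cos2 t) as E; unfold Rsqr in E.
      apply (Rmult_le_reg_r (cos t)); [exact Hc|]; unfold tan; rewrite Hyt.
      match goal with |- _ <= ?X => replace X with
        (cenx k * cos t + ceny k * sin t + rad k * (sin t * sin t + cos t * cos t) - snd z * sin t)
        by (field; lra) end.
      rewrite E; lra.
  - rewrite zone_sine_high by (exact Hk || lra); rewrite asin_sin by lra.
    pose proof (cos_beta_pos k Hk) as Hc.
    set (w := (y - cos (delta k) * sin (beta k)) / cos (beta k)).
    assert (Hyw : y = cos (delta k) * sin (beta k) + w * cos (beta k)) by (unfold w; field; lra).
    exists (cos (delta k) * cos (beta k) - w * sin (beta k)); split.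
    + rewrite Hyw; apply J1_zone_segment; [exact Hk|].
      rewrite yS_line in Hgt by exact Hk; unfold ztop, yT, pt_line in *; simpl in Hy.
      split; apply (Rmult_le_reg_r (cos (beta k))); lra.
    + intros z (_ & _ & Hz).
      assert (Ht : arc_angle k (beta k)) by (split; [exact Hk|lra]).
      specialize (Hz k (beta k) Ht).
      rewrite height_beta in Hz by exact Hk; revert Hz; plane; intros Hz.
      pose proof (sin2_cos2 (beta k)) as E; unfold Rsqr in E.
      apply (Rmult_le_reg_r (cos (beta k))); [exact Hc|]; unfold tan; rewrite Hyw.
      match goal with |- _ <= ?X => replace X with
        (cos (delta k) * (sin (beta k) * sin (beta k) + cos (beta k) * cos (beta k))
          - snd z * sin (beta k)) by (field; lra) end.
      rewrite E; lra.
Qed.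

(* [0] for [y <= 0]; the value for [1 < y] is irrelevant. *)
Definition normal_sine (y : R) : R :=
  epsilon (inhabits 0) (fun s => (y <= 0 /\ s = 0) \/ exists k, zone k y /\ s = zone_sine k y).

Lemma normal_sine_zone k y : zone k y -> normal_sine y = zone_sine k y.
Proof.
  intros Hk; unfold normal_sine; pose proof (zone_pos k y Hk) as Hy.
  destruct (epsilon_spec (inhabits 0)
    (fun s => (y <= 0 /\ s = 0) \/ exists k, zone k y /\ s = zone_sine k y)) as [[H _]|(j & Hj & E)].
  - exists (zone_sine k y); right; exists k; auto.
  - lra.
  - rewrite E; replace j with k; [reflexivity|].
    apply Nat.le_antisymm; [apply (zone_le k j y y)|apply (zone_le j k y y)]; auto; lra.
Qed.

Lemma normal_sine_nonpos y : y <= 0 -> normal_sine y = 0.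
Proof.
  intros Hy; unfold normal_sine.
  destruct (epsilon_spec (inhabits 0)
    (fun s => (y <= 0 /\ s = 0) \/ exists k, zone k y /\ s = zone_sine k y)) as [[_ E]|(j & Hj & _)].
  - exists 0; left; auto.
  - exact E.
  - pose proof (zone_pos j y Hj); lra.
Qed.

Lemma normal_sine_bounds y : y <= 1 -> 0 <= normal_sine y <= sin (beta 1).
Proof.
  intros Hy; pose proof (sin_beta_bounds 1 ltac:(lia)).
  destruct (Rle_dec y 0) as [Hneg|Hneg]; [rewrite normal_sine_nonpos by exact Hneg; lra|].
  destruct (zone_exists y ltac:(lra)) as [k Hk]; rewrite (normal_sine_zone k y Hk).
  assert (Hk1 : (1 <= k)%nat) by apply Hk.
  pose proof (zone_sine_bounds k y Hk1); pose proof (sin_beta_bounds (S k) ltac:(lia)).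
  pose proof (beta_mono 1 k ltac:(lia)); pose proof (beta_bounds 1 ltac:(lia)).
  pose proof (beta_bounds k Hk1).
  pose proof (sin_incr_1 (beta k) (beta 1) ltac:(lra) ltac:(lra) ltac:(lra) ltac:(lra) ltac:(lra)); lra.
Qed.

(* Zones are crossed downwards until [N]; what remains of the sine below [yT N] is at most
   [sin (beta N)]. *)
Lemma zone_sine_modulus L N j z y : 0 <= L -> (forall i, (1 <= i < N)%nat -> 1 <= L * rad i) ->
  zone j z -> y <= z ->
  normal_sine y <= zone_sine j z <= normal_sine y + L * (z - y) + sin (beta (max j N)).
Proof.
  intros HL HN; remember (N - j)%nat as m eqn:Em; revert j z Em.
  induction m as [|m IH]; intros j z Em Hj Hyz; assert (Hj1 : (1 <= j)%nat) by apply Hj.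
  - replace (max j N) with j by lia.
    pose proof (zone_sine_bounds j z Hj1) as Hb; pose proof (sin_beta_bounds (S j) ltac:(lia)).
    pose proof (normal_sine_bounds y ltac:(pose proof (zone_le_1 j z Hj); lra)).
    split; [|nra]; destruct (Rle_dec y 0) as [Hneg|Hneg]; [rewrite normal_sine_nonpos by exact Hneg; lra|].
    destruct (zone_exists y) as [k Hk]; [pose proof (zone_le_1 j z Hj); lra|].
    rewrite (normal_sine_zone k y Hk); assert (Hk1 : (1 <= k)%nat) by apply Hk.
    pose proof (zone_le j k y z Hk Hj Hyz) as Hjk.
    destruct (Nat.eq_dec k j) as [->|Hne]; [apply zone_sine_lipschitz; assumption|].
    pose proof (zone_sine_bounds k y Hk1) as Hbk; pose proof (beta_mono (S j) k ltac:(lia)).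
    pose proof (beta_bounds k Hk1); pose proof (beta_bounds (S j) ltac:(lia)).
    pose proof (sin_incr_1 (beta k) (beta (S j)) ltac:(lra) ltac:(lra) ltac:(lra) ltac:(lra) ltac:(lra)).
    lra.
  - assert (HLj := HN j ltac:(lia)); pose proof (rad_pos j Hj1) as Hr.
    assert (Hstep : forall d, 0 <= d -> d / rad j <= L * d).
    { intros d Hd; apply (Rmult_le_reg_r (rad j)); [exact Hr|].
      unfold Rdiv; rewrite Rmult_assoc, Rinv_l by lra; nra. }
    pose proof (sin_beta_bounds (max j N) ltac:(lia)).
    destruct (Rlt_dec (yT (S j)) y) as [Hy|Hy].
    + rewrite (normal_sine_zone j y) by (split; [exact Hj1|destruct Hj; lra]).
      pose proof (zone_sine_lipschitz j y z Hj1 Hyz); pose proof (Hstep (z - y) ltac:(lra)); lra.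
    (* Here [y] is below the zone of [z]: restart from the top of the next zone, where both zones
       give the sine [sin (beta (S j))]. *)
    + assert (HS : zone (S j) (yT (S j))) by (apply zone_yT; lia).
      destruct (IH (S j) (yT (S j)) ltac:(lia) HS ltac:(lra)) as [H1 H2].
      replace (max (S j) N) with (max j N) in H2 by lia.
      rewrite (zone_sine_high (S j)) in H1, H2 by (lia || (apply yS_le_yT; lia)).
      pose proof (zone_sine_lipschitz j (yT (S j)) z Hj1 ltac:(destruct Hj; lra)) as H3.
      rewrite (zone_sine_low j (yT (S j))) in H3 by (exact Hj1 || lra).
      pose proof (Hstep (z - yT (S j)) ltac:(destruct Hj; lra)); split; [lra|]; nra.
Qed.

(** Only finitely many radii constrain [L]; the error [sin (beta N)] pays for all lower arcs. Fixing
    a large [N] gives continuity, and letting [N] grow under a uniform radius bound gives the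
    Lipschitz property. *)
Lemma normal_sine_modulus L N y z : 0 <= L -> (1 <= N)%nat ->
  (forall i, (1 <= i < N)%nat -> 1 <= L * rad i) -> y <= z <= 1 ->
  normal_sine y <= normal_sine z <= normal_sine y + L * (z - y) + sin (beta N).
Proof.
  intros HL HN1 HN Hyz; pose proof (sin_beta_bounds N HN1).
  destruct (Rle_dec z 0) as [Hneg|Hneg].
  - rewrite !normal_sine_nonpos by lra; nra.
  - destruct (zone_exists z ltac:(lra)) as [j Hj]; rewrite (normal_sine_zone j z Hj).
    destruct (zone_sine_modulus L N j z y HL HN Hj ltac:(lra)) as [H1 H2]; split; [exact H1|].
    pose proof (beta_mono N (max j N) ltac:(lia)); pose proof (beta_bounds N HN1).
    pose proof (beta_bounds (max j N) ltac:(lia)).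
    pose proof (sin_incr_1 (beta (max j N)) (beta N) ltac:(lra) ltac:(lra) ltac:(lra) ltac:(lra) ltac:(lra)).
    lra.
Qed.

Lemma rad_bounded_below N : exists L, 0 <= L /\ forall i, (1 <= i < N)%nat -> 1 <= L * rad i.
Proof.
  induction N as [|N [L [HL IH]]]; [exists 0; split; [lra|intros i Hi; lia]|].
  destruct (Nat.eq_dec N 0) as [->|HN]; [exists 0; split; [lra|intros i Hi; lia]|].
  pose proof (rad_pos N ltac:(lia)) as Hr; exists (Rmax L (/ rad N)).
  split; [apply Rle_trans with (1 := HL), Rmax_l|]; intros i Hi.
  destruct (Nat.eq_dec i N) as [->|Hne].
  - rewrite <- (Rinv_l (rad N)) by lra; apply Rmult_le_compat_r; [lra|apply Rmax_r].
  - apply Rle_trans with (1 := IH i ltac:(lia)), Rmult_le_compat_r; [|apply Rmax_l].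
    apply Rlt_le, rad_pos; lia.
Qed.

Lemma sin_beta_small eps : 0 < eps -> exists N, (1 <= N)%nat /\ sin (beta N) < eps.
Proof.
  intros He; destruct (proj2 (is_lim_seq_spec _ _) beta_lim (mkposreal eps He)) as [n Hn].
  exists (S n); split; [lia|]; specialize (Hn (S n) ltac:(lia)); simpl in Hn.
  apply Rabs_def2 in Hn; pose proof (beta_bounds (S n) ltac:(lia)).
  pose proof (sin_lt_x (beta (S n)) ltac:(lra)); lra.
Qed.

Lemma normal_sine_continuous y : y < 1 -> continuous normal_sine y.
Proof.
  intros Hy; apply filterlim_locally; intros eps.
  destruct (sin_beta_small (eps / 2)) as (N & HN & Hs); [destruct eps; simpl; lra|].
  destruct (rad_bounded_below N) as (L & HL & Hrad).
  (* Half of [eps] is spent on the tail beyond [N]; [L + 1] avoids dividing by a zero [L]. *)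
  assert (Hd : 0 < Rmin (1 - y) (eps / 2 / (L + 1))).
  { apply Rmin_pos; [lra|]; apply Rdiv_lt_0_compat; [destruct eps; simpl; lra|lra]. }
  exists (mkposreal _ Hd); intros z Hz; change (Rabs (z - y) < Rmin (1 - y) (eps / 2 / (L + 1))) in Hz.
  change (Rabs (normal_sine z - normal_sine y) < eps).
  assert (Hz1 := Rlt_le_trans _ _ _ Hz (Rmin_l _ _)); assert (Hz2 := Rlt_le_trans _ _ _ Hz (Rmin_r _ _)).
  assert (Hz3 : L * Rabs (z - y) <= eps / 2).
  { apply (Rmult_lt_compat_r (L + 1)) in Hz2; [|lra].
    unfold Rdiv in Hz2 at 1; rewrite Rmult_assoc, Rinv_l in Hz2 by lra.
    pose proof (Rabs_pos (z - y)); nra. }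
  apply Rabs_def2 in Hz1.
  destruct (Rle_dec y z) as [H|H].
  - pose proof (normal_sine_modulus L N y z HL HN Hrad ltac:(lra)).
    rewrite Rabs_pos_eq in Hz3 by lra; rewrite Rabs_pos_eq by lra; lra.
  - pose proof (normal_sine_modulus L N z y HL HN Hrad ltac:(lra)).
    rewrite Rabs_left1 in Hz3 by lra; rewrite Rabs_left1 by lra; lra.
Qed.

Lemma normal_sine_lipschitz L y z : 0 <= L -> (forall i, (1 <= i)%nat -> 1 <= L * rad i) ->
  y <= 1 -> z <= 1 -> Rabs (normal_sine y - normal_sine z) <= L * Rabs (y - z).
Proof.
  intros HL Hrad.
  assert (W : forall y z, y <= z <= 1 -> normal_sine y <= normal_sine z <= normal_sine y + L * (z - y)).
  { clear y z; intros y z Hyz; split.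
    - apply (normal_sine_modulus L 1); auto; intros; lia.
    - apply le_epsilon; intros e He; destruct (sin_beta_small e He) as (N & HN & Hs).
      destruct (normal_sine_modulus L N y z) as [_ H]; auto; [intros; apply Hrad; lia|lra]. }
  intros Hy Hz; destruct (Rle_dec y z) as [H|H].
  - pose proof (W y z ltac:(lra)); rewrite !Rabs_left1 by lra; lra.
  - pose proof (W z y ltac:(lra)); rewrite !Rabs_pos_eq by lra; lra.
Qed.

Lemma top_support y : 0 <= y <= 1 ->
  exists x, J1 alpha (x, y) /\
    forall z, region z -> Re z <= x - tan (asin (normal_sine y)) * (Im z - y).
Proof.
  intros Hy; destruct (Req_dec y 0) as [->|H0].
  - exists 1; split; [apply convex_hull_incl; right; left; reflexivity|].
    intros z [Hz _]; rewrite normal_sine_nonpos, asin_0, tan_0 by lra; lra.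
  - destruct (zone_exists y ltac:(lra)) as [k Hk]; rewrite (normal_sine_zone k y Hk).
    exact (zone_support k y Hk).
Qed.

(** Choosing membership and the supporting line together makes the value both attained and maximal
    among abscissas at height [y]. *)
Definition top (y : R) : R :=
  epsilon (inhabits 0) (fun x => J1 alpha (x, y) /\
    forall z, region z -> Re z <= x - tan (asin (normal_sine y)) * (Im z - y)).

Lemma top_spec y : 0 <= y <= 1 -> J1 alpha (top y, y) /\
    forall z, region z -> Re z <= top y - tan (asin (normal_sine y)) * (Im z - y).
Proof. intros Hy; exact (epsilon_spec (inhabits 0) _ (top_support y Hy)). Qed.

Lemma J1_i : J1 alpha (0, 1).
Proof.
  pose proof (J1_zone_segment 1 (sin (delta 1)) ltac:(lia)) as H; rewrite <- ptA_line in H.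
  unfold ptA in H; destruct Halpha as [E _]; rewrite E, cos_PI2, sin_PI2 in H; apply H.
  pose proof (sin_delta_dec 1 ltac:(lia)); pose proof (sin_delta_pos 2 ltac:(lia)).
  pose proof (sin_delta_pos 1 ltac:(lia)); simpl; lra.
Qed.

Lemma convex_J1 : convex (J1 alpha).
Proof. apply convex_convex_hull. Qed.

(** A point of [region] lies on the horizontal segment from [(0, y)] to [(top y, y)], whose
    endpoints are both in [J1]. *)
Lemma J1_iff_region z : J1 alpha z <-> region z.
Proof.
  split; [apply J1_region|]; intros Hz; destruct z as [x y].
  assert (Hx : 0 <= x <= 1) by apply Hz; assert (Hy : 0 <= y <= 1) by apply Hz.
  destruct (top_spec y Hy) as [Htop Hle]; specialize (Hle (x, y) Hz); simpl in Hle.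
  rewrite Rminus_diag, Rmult_0_r in Hle.
  assert (H0 : J1 alpha (0, y)).
  { apply (convex_J1 (RtoC 0) (0, 1)); [apply convex_hull_incl; left; reflexivity|exact J1_i|].
    exists y; split; [lra|]; plane; f_equal; ring. }
  destruct (Req_dec (top y) 0) as [E|E].
  - replace x with 0 by lra; exact H0.
  - apply (convex_J1 _ _ _ H0 Htop); exists (x / top y); split.
    + split; [apply Rdiv_le_0_compat; lra|]; apply (Rmult_le_reg_r (top y)); [lra|].
      unfold Rdiv; rewrite Rmult_assoc, Rinv_l; lra.
    + plane; f_equal; field; lra.
Qed.

Lemma setK_iff z : setK alpha z <-> region (Rabs (Re z), Rabs (Im z)).
Proof.
  rewrite <- J1_iff_region; destruct z as [x y]; split.
  - intros H.
    assert (Hor : exists a b, J1 alpha (a, b) /\ (x = a \/ x = - a) /\ (y = b \/ y = - b)).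
    { destruct H as [H|[H|[H|H]]]; unfold J2 in H; revert H; unfold Cconj; plane; intros H;
        do 2 eexists; (split; [exact H|lra]). }
    destruct Hor as (a & b & H1 & Hx & Hy); pose proof (J1_region _ H1) as (Ha & Hb & _).
    simpl in *.
    replace (Rabs x) with a; [replace (Rabs y) with b; [exact H1|]|].
    + destruct Hy as [->| ->]; [|rewrite Rabs_Ropp]; rewrite Rabs_pos_eq; lra.
    + destruct Hx as [->| ->]; [|rewrite Rabs_Ropp]; rewrite Rabs_pos_eq; lra.
  - simpl; unfold setK, J3, J2, Cconj; plane; rewrite Ropp_involutive.
    unfold Rabs; destruct (Rcase_abs x), (Rcase_abs y); auto 6.
Qed.

(** * The boundary and its regularity *)

Lemma region_solid x y x' y' : region (x, y) -> 0 <= x' <= x -> 0 <= y' <= y -> region (x', y').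
Proof.
  intros (Hx & Hy & H) Hx' Hy'; simpl in *; split; [simpl; lra|split; [simpl; lra|]]; intros k t Ht.
  apply Rle_trans with (2 := H k t Ht); plane.
  pose proof (arc_angle_bounds k t Ht).
  pose proof (sin_ge_0 t ltac:(lra) ltac:(lra)); pose proof (cos_ge_0 t ltac:(lra) ltac:(lra)); nra.
Qed.

Lemma locally_abs_halfplane (p : C) (a b h : R) : 0 <= a <= 1 -> 0 <= b <= 1 ->
  h < a * Rabs (Re p) + b * Rabs (Im p) ->
  locally p (fun q : C => h < a * Rabs (Re q) + b * Rabs (Im q)).
Proof.
  (* Half the gap: each coordinate moves by less than [e] and the weights are at most 1, so the loss
     stays below the gap [2 * e]. *)
  intros Ha Hb Hp; set (e := (a * Rabs (Re p) + b * Rabs (Im p) - h) / 2).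
  assert (He : 0 < e) by (unfold e; lra).
  exists (mkposreal e He); intros q [Hx Hy].
  change (Rabs (Re q - Re p) < e) in Hx; change (Rabs (Im q - Im p) < e) in Hy.
  pose proof (Rabs_triang_inv (Re p) (Re q)) as H1; rewrite Rabs_minus_sym in H1.
  pose proof (Rabs_triang_inv (Im p) (Im q)) as H2; rewrite Rabs_minus_sym in H2.
  assert (a * Rabs (Re p) <= a * Rabs (Re q) + a * e) by nra.
  assert (b * Rabs (Im p) <= b * Rabs (Im q) + b * e) by nra.
  destruct (Req_dec (a + b) 0); [replace a with 0 in * by lra; replace b with 0 in * by lra; unfold e in *; nra|].
  assert (a * Rabs (Re p) < a * Rabs (Re q) + a * e \/ b * Rabs (Im p) < b * Rabs (Im q) + b * e).
  { destruct (Req_dec a 0); [right|left]; nra. }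
  assert (a * e <= e /\ b * e <= e) by nra.
  unfold e in *; lra.
Qed.

(** A point outside violates one defining inequality, of the form a |x| + b |y| <= h with weights
    between 0 and 1, and that violation persists nearby. *)
Lemma setK_closed p : ~ setK alpha p -> locally p (fun q => ~ setK alpha q).
Proof.
  intros Hp; rewrite setK_iff in Hp.
  assert (Hex : exists a b h, 0 <= a <= 1 /\ 0 <= b <= 1 /\
    h < a * Rabs (Re p) + b * Rabs (Im p) /\
    forall z, region z -> a * Re z + b * Im z <= h).
  { apply NNPP; intros Hn; apply Hp.
    assert (W : forall a b h, 0 <= a <= 1 -> 0 <= b <= 1 ->
      (forall z, region z -> a * Re z + b * Im z <= h) -> a * Rabs (Re p) + b * Rabs (Im p) <= h).
    { intros a b h Ha Hb Hz; apply Rnot_lt_le; intros Hlt; apply Hn; exists a, b, h; auto. }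
    pose proof (Rabs_pos (Re p)); pose proof (Rabs_pos (Im p)).
    split; [|split].
    - pose proof (W 1 0 1 ltac:(lra) ltac:(lra) ltac:(intros z Hz; destruct Hz; lra)); simpl; lra.
    - pose proof (W 0 1 1 ltac:(lra) ltac:(lra) ltac:(intros z Hz; destruct Hz as (_ & Hz & _); lra)); simpl; lra.
    - intros k t Ht; pose proof (arc_angle_bounds k t Ht).
      pose proof (sin_ge_0 t ltac:(lra) ltac:(lra)); pose proof (cos_ge_0 t ltac:(lra) ltac:(lra)).
      pose proof (COS_bound t); pose proof (SIN_bound t).
      assert (Hc := W (cos t) (sin t) (height k t) ltac:(lra) ltac:(lra)); plane; simpl in Hc.
      rewrite (Rmult_comm (Rabs _)), (Rmult_comm (Rabs (snd p))); apply Hc.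
      intros z (_ & _ & Hz); specialize (Hz k t Ht); revert Hz; plane; lra. }
  destruct Hex as (a & b & h & Ha & Hb & Hlt & Hz).
  apply (filter_imp (fun q : C => h < a * Rabs (Re q) + b * Rabs (Im q)));
    [|exact (locally_abs_halfplane p a b h Ha Hb Hlt)].
  intros q Hq HK; rewrite setK_iff in HK; specialize (Hz _ HK); simpl in Hz; lra.
Qed.

(** Moving from the boundary point at the height of [p] towards the top vertex gives a point of
    [region] exceeding [p] in both absolute coordinates, and everything below and left of it in the
    quadrant belongs to [region]. *)
Lemma setK_interior (p : C) : Rabs (Im p) < 1 -> 0 <= Re p < top (Rabs (Im p)) ->
  locally p (setK alpha).
Proof.
  intros Hy Hx; set (g := top (Rabs (Im p))) in *; pose proof (Rabs_pos (Im p)) as H0.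
  destruct (top_spec (Rabs (Im p)) ltac:(lra)) as [Htop _]; fold g in Htop.
  (* This fraction brings the abscissa (1 - e) g halfway between [Re p] and [g]. *)
  set (e := (g - Re p) / (2 * g)).
  assert (He : 0 < e <= 1).
  { unfold e; split; [apply Rdiv_lt_0_compat; lra|].
    apply (Rmult_le_reg_r (2 * g)); [lra|]; unfold Rdiv; rewrite Rmult_assoc, Rinv_l; lra. }
  assert (Hq : region ((g + Re p) / 2, Rabs (Im p) + e * (1 - Rabs (Im p)))).
  { apply J1_region, (convex_J1 _ _ _ Htop J1_i); exists e; split; [lra|].
    plane; f_equal; [unfold e, Re in *; field; lra|ring]. }
  assert (Hd : 0 < Rmin ((g - Re p) / 2) (e * (1 - Rabs (Im p)))) by (apply Rmin_pos; nra).
  exists (mkposreal _ Hd); intros q [Hqx Hqy].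
  change (Rabs (Re q - Re p) < Rmin ((g - Re p) / 2) (e * (1 - Rabs (Im p)))) in Hqx.
  change (Rabs (Im q - Im p) < Rmin ((g - Re p) / 2) (e * (1 - Rabs (Im p)))) in Hqy.
  assert (Hqx1 := Rlt_le_trans _ _ _ Hqx (Rmin_l _ _)).
  assert (Hqy1 := Rlt_le_trans _ _ _ Hqy (Rmin_r _ _)).
  apply setK_iff, (region_solid _ _ _ _ Hq).
  - pose proof (Rabs_triang_inv (Re q) (Re p)); pose proof (Rabs_pos (Re q)).
    rewrite (Rabs_pos_eq (Re p)) in * by lra; lra.
  - pose proof (Rabs_triang_inv (Im q) (Im p)); pose proof (Rabs_pos (Im q)); lra.
Qed.

Lemma region_le_top z : region z -> Re z <= top (Im z).
Proof.
  intros Hz; assert (Hy : 0 <= Im z <= 1) by apply Hz.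
  destruct (top_spec (Im z) Hy) as [_ H]; specialize (H z Hz).
  rewrite Rminus_diag, Rmult_0_r in H; lra.
Qed.

Lemma region_im_1 x : region (x, 1) -> x = 0.
Proof.
  intros (Hx & _ & H); simpl in Hx.
  assert (Ht : arc_angle 1 (beta 1)) by (split; [lia|pose proof (beta_dec 1 ltac:(lia)); lra]).
  specialize (H 1%nat (beta 1) Ht); rewrite height_beta in H by lia; revert H; plane.
  (* Since [alpha 1] is PI / 2, the first edge ends at the top vertex, and its halfplane at height 1
     reads [x * cos (beta 1) <= 0]. *)
  replace (delta 1) with (PI / 2 - beta 1) by
    (unfold delta, beta; destruct Halpha as [-> _]; lra).
  rewrite cos_shift; pose proof (cos_beta_pos 1 ltac:(lia)); nra.
Qed.

Definition boundary_fun (y : R) : R := top (Rabs y).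

Lemma right_boundary_fun_setK : right_boundary_fun (setK alpha) boundary_fun.
Proof.
  intros p; unfold boundary_fun; split.
  - intros [[Hint Hext] Hx].
    assert (HK : setK alpha p) by (apply NNPP; intros HK; exact (Hext (setK_closed p HK))).
    apply setK_iff in HK; rewrite (Rabs_pos_eq (Re p)) in HK by exact Hx.
    assert (Hy : Rabs (Im p) <= 1) by apply HK.
    split; [apply Rabs_le_between; exact Hy|].
    pose proof (region_le_top _ HK) as Hle; simpl in Hle.
    destruct (Req_dec (Rabs (Im p)) 1) as [E|E].
    + rewrite E in HK |- *; rewrite (region_im_1 _ HK); symmetry; apply region_im_1, J1_region, top_spec; lra.
    + apply Rle_antisym; [exact Hle|]; apply Rnot_lt_le; intros Hlt; apply Hint, setK_interior; lra.
  - intros [Hy Hx]; apply Rabs_le_between in Hy; pose proof (Rabs_pos (Im p)) as Hpos.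
    destruct (top_spec (Rabs (Im p)) ltac:(lra)) as [Htop _]; apply J1_region in Htop.
    assert (Hx0 : 0 <= Re p) by (rewrite Hx; apply Htop).
    split; [|exact Hx0]; split; intros Hloc.
    + destruct Hloc as [e He]; specialize (He (Re p + e / 2, Im p)).
      assert (HK : setK alpha (Re p + e / 2, Im p)).
      { apply He; destruct e as [e He0]; split; [|apply ball_center].
        change (Rabs (Re p + e / 2 - Re p) < e).
        replace (_ - _) with (e / 2) by ring; rewrite Rabs_pos_eq; lra. }
      apply setK_iff, region_le_top in HK; simpl in HK; destruct e as [e He0]; simpl in *.
      rewrite Rabs_pos_eq in HK by lra; unfold Re, Im in *; lra.
    + apply locally_singleton in Hloc; apply Hloc, setK_iff.
      rewrite (Rabs_pos_eq (Re p)), Hx by exact Hx0; exact Htop.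
Qed.

(** As [normal_sine] vanishes on nonpositive heights, one term is zero on each side of 0; the
    difference is the odd extension of the slope. *)
Definition boundary_slope (y : R) : R :=
  tan (asin (normal_sine (- y))) - tan (asin (normal_sine y)).

Lemma normal_tan_nonneg y : y <= 1 -> 0 <= tan (asin (normal_sine y)).
Proof.
  intros Hy; pose proof (normal_sine_bounds y Hy); pose proof (sin_beta_bounds 1 ltac:(lia)).
  rewrite tan_asin by lra; apply Rdiv_le_0_compat; [lra|apply sqrt_lt_R0; unfold Rsqr; nra].
Qed.

(** The supporting line at [Rabs y] is tested at [Rabs y']; replacing [Rabs y'] by [y'] or [- y']
    loses in the right direction because the tangent is nonnegative. *)
Lemma boundary_fun_support y y' : -1 <= y <= 1 -> -1 <= y' <= 1 ->
  boundary_fun y' <= boundary_fun y + boundary_slope y * (y' - y).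
Proof.
  intros Hy Hy'; unfold boundary_fun, boundary_slope.
  pose proof (proj2 (Rabs_le_between y 1) Hy); pose proof (proj2 (Rabs_le_between y' 1) Hy').
  pose proof (Rabs_pos y); pose proof (Rabs_pos y').
  destruct (top_spec (Rabs y) ltac:(lra)) as [_ Hs].
  specialize (Hs (top (Rabs y'), Rabs y') (J1_region _ (proj1 (top_spec (Rabs y') ltac:(lra))))).
  simpl in Hs; destruct (Rle_dec 0 y).
  - rewrite (normal_sine_nonpos (- y)), asin_0, tan_0 by lra; rewrite (Rabs_pos_eq y) in * by lra.
    pose proof (normal_tan_nonneg y ltac:(lra)); pose proof (Rle_abs y'); nra.
  - rewrite (normal_sine_nonpos y), asin_0, tan_0 by lra.
    rewrite (Rabs_left1 y) in * by lra.
    pose proof (normal_tan_nonneg (- y) ltac:(lra)).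
    pose proof (Rle_abs (- y')) as Ha; rewrite Rabs_Ropp in Ha; nra.
Qed.

Lemma continuous_tan_asin s : -1 < s < 1 -> continuous (fun u => tan (asin u)) s.
Proof.
  intros Hs; apply (continuous_comp asin tan).
  - apply continuity_pt_filterlim, derivable_continuous_pt, derivable_pt_asin; exact Hs.
  - apply continuity_pt_filterlim, derivable_continuous_pt, derivable_pt_tan; pose proof (asin_bound_lt s Hs); lra.
Qed.

Lemma normal_sine_lt_1 y : y <= 1 -> -1 < normal_sine y < 1.
Proof. intros Hy; pose proof (normal_sine_bounds y Hy); pose proof (sin_beta_bounds 1 ltac:(lia)); lra. Qed.

Lemma boundary_slope_continuous y : -1 < y < 1 -> continuous boundary_slope y.
Proof.
  intros Hy; apply (continuous_minus (V := R_NormedModule)).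
  - apply (continuous_comp (fun z => normal_sine (- z)) (fun u => tan (asin u))).
    + apply (continuous_comp Ropp normal_sine); [apply (continuous_opp (V := R_NormedModule)), continuous_id|].
      apply normal_sine_continuous; lra.
    + apply continuous_tan_asin, normal_sine_lt_1; lra.
  - apply (continuous_comp normal_sine (fun u => tan (asin u))).
    + apply normal_sine_continuous; lra.
    + apply continuous_tan_asin, normal_sine_lt_1; lra.
Qed.

Lemma boundary_fun_derive y : -1 < y < 1 -> is_derive boundary_fun y (boundary_slope y).
Proof.
  intros Hy; apply (supergradient_is_derive boundary_fun boundary_slope (-1) 1 y Hy).
  - intros u v Hu Hv; apply boundary_fun_support; lra.
  - apply boundary_slope_continuous; exact Hy.
Qed.

Lemma locally_open_interval a b y : a < y < b -> locally y (fun z : R => a < z < b).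
Proof.
  intros Hy; apply filter_and; [apply (open_gt a)|apply (open_lt b)]; lra.
Qed.

Lemma boundary_fun_C1 : C1_near boundary_fun 0.
Proof.
  unfold C1_near; apply (filter_imp (fun y => -1 < y < 1)); [|apply locally_open_interval; lra].
  intros y Hy; split; [exists (boundary_slope y); apply boundary_fun_derive; exact Hy|].
  apply (continuous_ext_loc (Derive boundary_fun) boundary_slope y); [|apply boundary_slope_continuous; exact Hy].
  apply (filter_imp (fun y => -1 < y < 1)); [|apply locally_open_interval; exact Hy].
  intros z Hz; symmetry; apply is_derive_unique, boundary_fun_derive; exact Hz.
Qed.

(** All admissible graphs agree on the open interval, so a failure of regularity for one of them is
    a failure for all. *)
Lemma right_boundary_fun_Derive x y : right_boundary_fun (setK alpha) x -> -1 < y < 1 ->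
  Derive x y = boundary_slope y.
Proof.
  intros Hx Hy; rewrite <- (is_derive_unique _ _ _ (boundary_fun_derive y Hy)).
  apply Derive_ext_loc, (filter_imp (fun y => -1 < y < 1)); [|apply locally_open_interval; exact Hy].
  intros z Hz.
  destruct (proj2 (right_boundary_fun_setK (boundary_fun z, z)) ltac:(simpl; split; [lra|reflexivity])) as [H1 H2].
  destruct (proj1 (Hx (boundary_fun z, z)) (conj H1 H2)) as [_ E]; simpl in E; symmetry; exact E.
Qed.

Lemma boundary_C1_setK : boundary_C1 (setK alpha).
Proof. exists boundary_fun; split; [exact right_boundary_fun_setK|exact boundary_fun_C1]. Qed.

Lemma boundary_C11_of_rad L : 0 <= L -> (forall i, (1 <= i)%nat -> 1 <= L * rad i) ->
  boundary_C11 (setK alpha).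
Proof.
  intros HL Hrad; exists boundary_fun; split; [exact right_boundary_fun_setK|].
  split; [exact boundary_fun_C1|].
  pose proof (sin_beta_bounds 1 ltac:(lia)) as Hq.
  destruct (tan_asin_lipschitz (sin (beta 1)) ltac:(lra)) as (M & HM & HF).
  (* Each of the two terms of [boundary_slope] contributes [M * L]. *)
  exists (2 * (M * L)), 1; split; [lra|]; intros y z Hy Hz.
  rewrite Rminus_0_r in Hy, Hz; apply Rabs_def2 in Hy; apply Rabs_def2 in Hz.
  rewrite (is_derive_unique _ _ _ (boundary_fun_derive y ltac:(lra))).
  rewrite (is_derive_unique _ _ _ (boundary_fun_derive z ltac:(lra))).
  assert (W : forall u v, u <= 1 -> v <= 1 ->
    Rabs (tan (asin (normal_sine u)) - tan (asin (normal_sine v))) <= M * L * Rabs (u - v)).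
  { intros u v Hu Hv; rewrite Rmult_assoc.
    apply Rle_trans with (1 := HF _ _ (normal_sine_bounds u Hu) (normal_sine_bounds v Hv)).
    apply Rmult_le_compat_l; [exact HM|]; apply normal_sine_lipschitz; assumption. }
  unfold boundary_slope.
  pose proof (W (- y) (- z) ltac:(lra) ltac:(lra)) as H1.
  pose proof (W z y ltac:(lra) ltac:(lra)) as H2.
  replace (- y - - z) with (- (y - z)) in H1 by ring; rewrite Rabs_Ropp in H1.
  rewrite (Rabs_minus_sym z y) in H2.
  match goal with |- Rabs ?X <= _ => replace X with
    ((tan (asin (normal_sine (- y))) - tan (asin (normal_sine (- z))))
     + (tan (asin (normal_sine z)) - tan (asin (normal_sine y)))) by ring end.
  apply Rle_trans with (1 := Rabs_triang _ _); lra.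
Qed.

(** The Lipschitz bound is tested at the two ends of the [k]-th arc: their heights differ by [rad k]
    times the difference of the sines, and that difference cancels. *)
Lemma rad_of_boundary_C11 : boundary_C11 (setK alpha) ->
  exists L N, forall i, (N <= i)%nat -> (1 <= i)%nat -> 1 <= L * rad i.
Proof.
  intros (x & Hx & _ & L & e & He & HL); exists L.
  destruct (proj2 (is_lim_seq_spec _ _) beta_lim (mkposreal e He)) as [N HN]; exists N.
  intros k HNk Hk; specialize (HN k HNk); simpl in HN.
  apply Rabs_def2 in HN; pose proof (yT_le_beta k Hk).
  pose proof (yT_lt_yS k Hk); pose proof (yS_le_yT k Hk); pose proof (yT_pos (S k) ltac:(lia)).
  pose proof (sin_beta_bounds k Hk); pose proof (sin_beta_bounds (S k) ltac:(lia)).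
  pose proof (sin_beta_dec k Hk).
  assert (HyS1 : yS k < 1).
  { pose proof (yT_lt_yS k Hk); unfold yT in *; pose proof (COS_bound (delta k)).
    pose proof (cos_delta_pos k Hk); nra. }
  assert (Es : normal_sine (yS k) = sin (beta k)).
  { rewrite (normal_sine_zone k _ (zone_yS k Hk)); apply zone_sine_high; [exact Hk|lra]. }
  assert (Et : normal_sine (yT (S k)) = sin (beta (S k))).
  { rewrite (normal_sine_zone (S k) _ (zone_yT (S k) ltac:(lia))).
    apply zone_sine_high; [lia|apply yS_le_yT; lia]. }
  assert (Hlip := HL (yT (S k)) (yS k)); rewrite !Rminus_0_r in Hlip.
  rewrite !Rabs_pos_eq in Hlip by lra.
  specialize (Hlip ltac:(lra) ltac:(lra)).
  rewrite !(right_boundary_fun_Derive x) in Hlip by (exact Hx || lra).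
  unfold boundary_slope in Hlip.
  rewrite Es, Et, !normal_sine_nonpos, asin_0, tan_0 in Hlip by lra.
  pose proof (tan_asin_expand (sin (beta (S k))) (sin (beta k)) ltac:(lra) ltac:(lra)) as Hexp.
  replace (0 - tan (asin (sin (beta (S k)))) - (0 - tan (asin (sin (beta k)))))
    with (tan (asin (sin (beta k))) - tan (asin (sin (beta (S k))))) in Hlip by ring.
  rewrite Rabs_pos_eq in Hlip by lra.
  rewrite Rabs_left1 in Hlip by lra; rewrite yT_corner in Hlip; unfold yS in Hlip.
  apply (Rmult_le_reg_r (sin (beta k) - sin (beta (S k)))); [lra|]; lra.
Qed.

(** Bounding sin above and tan below by their arguments leaves 2 (b - c) / (a - c) for consecutive
    terms a, b, c, and b < a bounds this by 2 b / a. *)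
Lemma rad_upper k : (1 <= k)%nat -> rad k <= 2 * (alpha (S k) / alpha k).
Proof.
  intros Hk; pose proof (half_turn_bounds k Hk) as Hg; pose proof (delta_bounds (S k) ltac:(lia)).
  pose proof (sin_lt_x (delta (S k)) ltac:(lra)) as Hs.
  pose proof (le_tan _ ltac:(split; [apply Rlt_le, Hg|lra])) as Ht.
  pose proof (alpha_dec k Hk); pose proof (alpha_dec (S k) ltac:(lia)).
  pose proof (alpha_pos (S (S k)) ltac:(lia)).
  apply Rle_trans with (delta (S k) / ((beta k - beta (S k)) / 2)).
  - unfold rad, Rdiv at 1; unfold Rdiv at 3; apply Rmult_le_compat.
    + apply Rlt_le, sin_delta_pos; lia.
    + apply Rlt_le, Rinv_0_lt_compat; lra.
    + lra.
    + apply Rinv_le_contravar; lra.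
  - unfold delta, beta; set (a := alpha k) in *; set (b := alpha (S k)) in *; set (c := alpha (S (S k))) in *.
    replace ((b - c) / 2 / (((a + b) / 2 - (b + c) / 2) / 2)) with (2 * ((b - c) / (a - c))) by (field; lra).
    apply Rmult_le_compat_l; [lra|]; apply (Rmult_le_reg_r (a - c)); [lra|].
    replace ((b - c) / (a - c) * (a - c)) with (b - c) by (field; lra).
    apply (Rmult_le_reg_r a); [lra|].
    replace (b / a * (a - c) * a) with (b * (a - c)) by (field; lra); nra.
Qed.

(** The half turning angle is below PI / 4, so its cosine is at least 1/2; together with
    [sin_ge_half] this linearises the radius up to the factor 4. *)
Lemma rad_lower k : (1 <= k)%nat ->
  (alpha (S k) - alpha (S (S k))) / (2 * (alpha k - alpha (S (S k)))) <= rad k.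
Proof.
  intros Hk; pose proof (half_turn_bounds k Hk) as Hg; pose proof (delta_bounds (S k) ltac:(lia)) as Hd.
  pose proof PI_4; pose proof PI_RGT_0.
  pose proof (sin_ge_half (delta (S k)) ltac:(lra)) as Hs.
  pose proof (alpha_dec k Hk); pose proof (alpha_dec (S k) ltac:(lia)).
  pose proof (sin_lt_x ((beta k - beta (S k)) / 2) ltac:(lra)) as Hs2.
  assert (Hc : 1 / 2 <= cos ((beta k - beta (S k)) / 2))
    by (rewrite <- cos_PI3; apply cos_decr_1; lra).
  assert (Hs3 : 0 < sin ((beta k - beta (S k)) / 2)) by (apply sin_gt_0; lra).
  unfold rad, tan; set (g := (beta k - beta (S k)) / 2) in *.
  replace (_ / _) with ((delta (S k) / 2) * (1 / 2) * / g) by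
    (unfold g, beta, delta; field; lra).
  replace (sin (delta (S k)) / (sin g / cos g)) with (sin (delta (S k)) * cos g * / sin g) by (field; lra).
  assert (0 < / g) by (apply Rinv_0_lt_compat; lra).
  apply Rmult_le_compat; [nra|lra| |apply Rinv_le_contravar; lra].
  apply Rmult_le_compat; lra.
Qed.

Lemma not_boundary_C11 : is_lim_seq (fun k => alpha (S k) / alpha k) 0 ->
  ~ boundary_C11 (setK alpha).
Proof.
  intros Hlim HC; destruct (rad_of_boundary_C11 HC) as (L & N & HL).
  (* With ratios below this value [rad_upper] yields radii below 1 / (|L| + 1), against
     [1 <= L * rad k]. *)
  assert (He : 0 < / (2 * (Rabs L + 1))) by (apply Rinv_0_lt_compat; pose proof (Rabs_pos L); lra).
  destruct (proj2 (is_lim_seq_spec _ _) Hlim (mkposreal _ He)) as [M HM].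
  set (k := S (max N M)); specialize (HM k ltac:(unfold k; lia)); simpl in HM.
  specialize (HL k ltac:(unfold k; lia) ltac:(unfold k; lia)).
  pose proof (rad_upper k ltac:(unfold k; lia)); pose proof (rad_pos k ltac:(unfold k; lia)).
  rewrite Rminus_0_r in HM; apply Rabs_def2 in HM as [HM _].
  apply (Rmult_lt_compat_l (2 * (Rabs L + 1))) in HM; [|pose proof (Rabs_pos L); lra].
  rewrite Rinv_r in HM by (pose proof (Rabs_pos L); lra).
  pose proof (Rle_abs L); pose proof (Rabs_pos L); nra.
Qed.

(** * The metric projection *)

Lemma setK_dot_le k t z : arc_angle k t -> setK alpha z -> dot z (unit t) <= height k t.
Proof.
  intros Ht Hz; apply setK_iff in Hz; destruct Hz as (_ & _ & Hz).
  apply Rle_trans with (2 := Hz k t Ht); plane.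
  pose proof (arc_angle_bounds k t Ht).
  pose proof (sin_ge_0 t ltac:(lra) ltac:(lra)); pose proof (cos_ge_0 t ltac:(lra) ltac:(lra)).
  pose proof (Rle_abs (fst z)); pose proof (Rle_abs (snd z)); nra.
Qed.

Lemma onarc_dot_self k t : dot (onarc k t) (unit t) = height k t.
Proof.
  pose proof (sin2_cos2 t) as E; unfold Rsqr in E; unfold onarc, height; plane.
  transitivity (cenx k * cos t + ceny k * sin t + rad k * (sin t * sin t + cos t * cos t));
    [ring|rewrite E; ring].
Qed.

(* The normal line of the arc at [onarc k t] meets the vertical line through [(2, 0)] at this
   height. *)
Definition source (k : nat) (t : R) : R := Im (onarc k t) + (2 - Re (onarc k t)) * tan t.

Lemma region_onarc k t : arc_angle k t -> region (onarc k t).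
Proof.
  intros Ht; apply J1_region, convex_hull_incl; right; right; left.
  exists (S k); split; [destruct Ht; lia|apply arc_onarc; exact Ht].
Qed.

Lemma region_setK z : region z -> setK alpha z.
Proof. intros Hz; left; apply J1_iff_region; exact Hz. Qed.

(** The vector from the arc point to its source is a nonnegative multiple of the outer normal, the
    abscissa of the arc point being at most 1. *)
Lemma proj_source k t : arc_angle k t -> proj (setK alpha) (2, source k t) = onarc k t.
Proof.
  intros Ht; pose proof (arc_angle_bounds k t Ht); pose proof (region_onarc k t Ht) as Hreg.
  assert (Hc : 0 < cos t) by (apply cos_gt_0; lra).
  apply proj_of_halfplane; [apply region_setK; exact Hreg|]; intros q Hq.
  pose proof (setK_dot_le k t q Ht Hq) as H1; rewrite <- onarc_dot_self in H1.
  destruct Hreg as [Hx _].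
  replace ((2, source k t) - onarc k t)%C
    with (((2 - Re (onarc k t)) / cos t)%R * unit t)%C.
  - replace (dot (q - onarc k t)%C (((2 - Re (onarc k t)) / cos t)%R * unit t)%C)
      with ((2 - Re (onarc k t)) / cos t * (dot q (unit t) - dot (onarc k t) (unit t))) by
      (unfold Rdiv; plane; ring).
    assert (0 <= (2 - Re (onarc k t)) / cos t) by (apply Rdiv_le_0_compat; lra); nra.
  - unfold source; destruct (onarc k t) as [px py]; plane; unfold tan; f_equal; field; lra.
Qed.

Lemma proj_2 : proj (setK alpha) (2, 0) = (1, 0).
Proof.
  apply proj_of_halfplane; [apply region_setK, region_1|]; intros q Hq.
  apply setK_iff in Hq; destruct Hq as [Hx _]; simpl in Hx.
  pose proof (Rle_abs (Re q)); destruct q as [qx qy]; simpl in *; plane; lra.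
Qed.

Lemma arc_angle_low k : (1 <= k)%nat -> arc_angle k (beta (S k)).
Proof. intros Hk; split; [exact Hk|pose proof (beta_dec k Hk); lra]. Qed.

Lemma arc_angle_high k : (1 <= k)%nat -> arc_angle k (beta k).
Proof. intros Hk; split; [exact Hk|pose proof (beta_dec k Hk); lra]. Qed.

Lemma source_low k : source k (beta (S k)) = 2 * tan (beta (S k)).
Proof.
  unfold source; rewrite <- ptT_onarc, ptT_beta; simpl; unfold tan.
  pose proof (cos_beta_pos (S k) ltac:(lia)); field; lra.
Qed.

Lemma beta_incr_lim : is_lim_seq (fun n => beta (S n)) 0.
Proof. apply (is_lim_seq_incr_1 beta), beta_lim. Qed.

Lemma tan_beta_lim : is_lim_seq (fun n => tan (beta (S n))) 0.
Proof.
  rewrite <- tan_0; apply (is_lim_seq_continuous tan); [|exact beta_incr_lim].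
  apply derivable_continuous_pt, derivable_pt_tan; pose proof PI_RGT_0; lra.
Qed.

(** The horizontal distance to the line x = 2 is between 1 and 2. The lower bound keeps the
    quotients at the upper ends of the arcs small; the upper one makes the sources tend to 0. *)
Lemma source_bounds k t : arc_angle k t ->
  Im (onarc k t) + t <= source k t <= Im (onarc k t) + 2 * tan t.
Proof.
  intros Ht; pose proof (arc_angle_bounds k t Ht); destruct (region_onarc k t Ht) as (Hx & _ & _).
  pose proof (le_tan t ltac:(lra)); unfold source; nra.
Qed.

Lemma Im_onarc_high k : (1 <= k)%nat ->
  0 < Im (onarc k (beta k)) <= alpha (S k) + delta (S k).
Proof.
  intros Hk; rewrite <- ptS_onarc by exact Hk.
  assert (E : ptS alpha (S k) = (ptA alpha (S k) - (ptA alpha (S k) - ptS alpha (S k)))%C) by ring.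
  rewrite ptA_sub_ptS in E by exact Hk; rewrite E; unfold ptA; plane.
  pose proof (alpha_pos (S k) ltac:(lia)); pose proof (alpha_le (S k) ltac:(lia)).
  pose proof (delta_bounds (S k) ltac:(lia)).
  pose proof (sin_lt_x (alpha (S k)) ltac:(lra)); pose proof (sin_lt_x (delta (S k)) ltac:(lra)).
  pose proof (sin_gt_0 (alpha (S k)) ltac:(lra) ltac:(pose proof PI_RGT_0; lra)).
  pose proof (sin_delta_pos (S k) ltac:(lia)); pose proof (cos_beta_pos k Hk).
  pose proof (COS_bound (beta k)); nra.
Qed.

(** The left side of the hypothesis bounds the height of [ptS (S k)], so [th] compares this height
    with the normal angle there; [th < 1] forces quotients at most th / (1 + th) < 1/2. *)
Lemma not_ex_dir_derive_proj th : 0 <= th < 1 ->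
  (forall k, (1 <= k)%nat -> alpha (S k) + delta (S k) <= th * beta k) ->
  ~ ex_dir_derive (proj (setK alpha)) (0, 1) (2, 0).
Proof.
  intros Hth Hle [l Hl].
  (* Along any arc points whose sources tend to 0, the quotient of height by source tends to
     [Im l]. *)
  assert (W : forall (a : nat -> nat) (t : nat -> R), (forall n, arc_angle (a n) (t n)) ->
    (forall n, 0 < Im (onarc (a n) (t n))) ->
    is_lim_seq (fun n => source (a n) (t n)) 0 ->
    is_lim_seq (fun n => Im (onarc (a n) (t n)) / source (a n) (t n)) (Im l)).
  { intros a t Hat Him Hs.
    apply (dir_derive_seq (proj (setK alpha)) (0, 1) (2, 0) l) with (1 := Hl) in Hs.
    - apply is_lim_seq_ext with (2 := Hs); intros n.
      replace ((2, 0) + source (a n) (t n) * (0, 1))%C with ((2, source (a n) (t n)) : C)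
        by (plane; f_equal; ring).
      rewrite proj_source, proj_2 by apply Hat; simpl; f_equal; ring.
    - intros n; pose proof (source_bounds _ _ (Hat n)); pose proof (arc_angle_bounds _ _ (Hat n)).
      specialize (Him n); lra. }
  (* Lower ends of the arcs, the points [ptT]. Indices start at [S n] because arcs are numbered from
     1. *)
  assert (H1 : Im l = 1 / 2).
  { assert (Hlim := W S (fun n => beta (S (S n))) (fun n => arc_angle_low (S n) ltac:(lia))).
    assert (Hb : is_lim_seq (fun n => beta (S (S n))) 0)
      by (apply (is_lim_seq_incr_1 (fun n => beta (S n))), beta_incr_lim).
    assert (Hdlt : is_lim_seq (fun n => delta (S (S n))) 0).
    { apply (is_lim_seq_le_le (fun _ => 0) _ (fun n => beta (S n))); [|apply is_lim_seq_const|exact beta_incr_lim].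
      intros n; pose proof (delta_bounds (S (S n)) ltac:(lia)); unfold delta, beta in *.
      pose proof (alpha_pos (S (S (S n))) ltac:(lia)); pose proof (alpha_dec (S n) ltac:(lia)); lra. }
    assert (Hex : forall n, cos (delta (S (S n))) * cos (beta (S (S n))) / 2
      = Im (onarc (S n) (beta (S (S n)))) / source (S n) (beta (S (S n)))).
    { intros n; rewrite source_low, <- ptT_onarc, ptT_beta; simpl; unfold tan.
      pose proof (cos_beta_pos (S (S n)) ltac:(lia)); pose proof (sin_beta_bounds (S (S n)) ltac:(lia)).
      field; lra. }
    assert (Hhalf : is_lim_seq (fun n => cos (delta (S (S n))) * cos (beta (S (S n))) / 2) (1 / 2)).
    { replace (1 / 2) with (cos 0 * cos 0 * / 2) by (rewrite cos_0; lra).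
      apply (is_lim_seq_scal_r _ (/ 2) (cos 0 * cos 0)).
      apply (is_lim_seq_mult' _ _ (cos 0) (cos 0)); apply (is_lim_seq_continuous cos); auto;
        apply derivable_continuous_pt, derivable_pt_cos. }
    apply (is_lim_seq_ext _ _ _ Hex) in Hhalf.
    assert (E : Finite (Im l) = Finite (1 / 2)); [|injection E; auto].
    rewrite <- (is_lim_seq_unique _ _ Hhalf); symmetry; apply is_lim_seq_unique, Hlim.
    - intros n; rewrite <- ptT_onarc, ptT_beta; simpl; apply (yT_pos (S (S n))); lia.
    - apply (is_lim_seq_ext (fun n => 2 * tan (beta (S (S n))))); [intros n; symmetry; apply source_low|].
      replace 0 with (2 * 0) by ring.
      apply (is_lim_seq_scal_l _ 2 0), (is_lim_seq_incr_1 (fun n => tan (beta (S n)))), tan_beta_lim. }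
  assert (H2 : Im l <= th / (1 + th)).
  { assert (Hlim := W S (fun n => beta (S n)) (fun n => arc_angle_high (S n) ltac:(lia))
      (fun n => proj1 (Im_onarc_high (S n) ltac:(lia)))).
    assert (Hs0 : is_lim_seq (fun n => source (S n) (beta (S n))) 0).
    { apply (is_lim_seq_le_le (fun _ => 0) _ (fun n => 1 * beta (S n) + 2 * tan (beta (S n)))).
      - intros n; pose proof (source_bounds _ _ (arc_angle_high (S n) ltac:(lia))).
        pose proof (Im_onarc_high (S n) ltac:(lia)); pose proof (Hle (S n) ltac:(lia)).
        pose proof (beta_bounds (S n) ltac:(lia)); split; nra.
      - apply is_lim_seq_const.
      - replace 0 with (1 * 0 + 2 * 0) by ring.
        apply (is_lim_seq_plus' _ _ (1 * 0) (2 * 0)).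
        + apply (is_lim_seq_scal_l _ 1 0), beta_incr_lim.
        + apply (is_lim_seq_scal_l _ 2 0), tan_beta_lim. }
    apply (is_lim_seq_le _ (fun _ => th / (1 + th)) (Im l) (th / (1 + th))) with (2 := Hlim Hs0);
      [|apply is_lim_seq_const].
    intros n; pose proof (source_bounds _ _ (arc_angle_high (S n) ltac:(lia))) as Hs.
    pose proof (Im_onarc_high (S n) ltac:(lia)); pose proof (Hle (S n) ltac:(lia)).
    pose proof (beta_bounds (S n) ltac:(lia)).
    (* From p <= th beta and beta <= s - p follows (1 + th) p <= th s. *)
    set (p := Im (onarc (S n) (beta (S n)))) in *; set (s := source (S n) (beta (S n))) in *.
    apply (Rmult_le_reg_r (s * (1 + th))); [nra|].
    replace (p / s * (s * (1 + th))) with (p * (1 + th)) by (field; lra).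
    replace (th / (1 + th) * (s * (1 + th))) with (th * s) by (field; lra); nra. }
  rewrite H1 in H2; apply (Rmult_le_compat_r (2 * (1 + th))) in H2; [|lra].
  replace (th / (1 + th) * (2 * (1 + th))) with (2 * th) in H2 by (field; lra); lra.
Qed.

End Construction.

(** * The two explicit sequences *)

Theorem theorem2p6 (alpha : nat -> R) (Halpha : defining_sequence alpha) :
  (forall c lambda : R, 0 < c -> 0 < lambda < 1 ->
     (forall n : nat, (1 <= n)%nat -> alpha n = c * lambda ^ n) ->
     boundary_C11 (setK alpha) /\
     ~ ex_dir_derive (proj (setK alpha)) (0, 1) (2, 0))
  /\
  (forall c lambda : R, 0 < c -> 0 < lambda < 1 / 2 ->
     (forall n : nat, (1 <= n)%nat -> alpha n = c * lambda ^ (n ^ 2)) ->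
     (boundary_C1 (setK alpha) /\ ~ boundary_C11 (setK alpha)) /\
     ~ ex_dir_derive (proj (setK alpha)) (0, 1) (2, 0)).
Proof.
  split; intros c lambda Hc Hl Ha.
  - assert (Hstep : forall k, (1 <= k)%nat -> alpha (S k) = lambda * alpha k)
      by (intros k Hk; rewrite !Ha by lia; simpl; ring).
    assert (Hstep2 : forall k, (1 <= k)%nat -> alpha (S (S k)) = lambda * (lambda * alpha k))
      by (intros k Hk; rewrite !Hstep by lia; reflexivity).
    split.
    (* For ratio [lambda] the bound of [rad_lower] is lambda / (2 (1 + lambda)) at every arc; the
       constant is its reciprocal. *)
    + apply (boundary_C11_of_rad alpha Halpha (2 * (1 + lambda) / lambda)).
      { apply Rdiv_le_0_compat; lra. }
      intros k Hk; pose proof (rad_lower alpha Halpha k Hk) as Hr.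
      pose proof (alpha_pos alpha Halpha k Hk) as Hp; rewrite Hstep2, Hstep in Hr by exact Hk.
      assert (Hd : 0 < alpha k * (1 - lambda) * (1 + lambda))
        by (repeat apply Rmult_lt_0_compat; lra).
      replace (_ / _) with (lambda / (2 * (1 + lambda))) in Hr
        by (field; repeat split; lra || (apply Rgt_not_eq; lra)).
      apply Rle_trans with (2 * (1 + lambda) / lambda * (lambda / (2 * (1 + lambda))));
        [right; field; lra|].
      apply Rmult_le_compat_l; [apply Rdiv_le_0_compat; lra|exact Hr].
    (* This is the exact ratio of [alpha (S k) + delta (S k)] to [beta k]; it is below 1 because (1
       - lambda)^2 > 0. *)
    + apply (not_ex_dir_derive_proj alpha Halpha (lambda * (3 - lambda) / (1 + lambda))).
      { split; [apply Rdiv_le_0_compat; nra|].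
        apply (Rmult_lt_reg_r (1 + lambda)); [lra|]; unfold Rdiv; rewrite Rmult_assoc, Rinv_l by lra; nra. }
      intros k Hk; unfold delta, beta; rewrite Hstep2, Hstep by exact Hk.
      right; field; lra.
  - assert (Hstep : forall k, (1 <= k)%nat -> alpha (S k) = lambda ^ (2 * k + 1) * alpha k).
    { intros k Hk; rewrite !Ha by lia.
      replace (S k ^ 2)%nat with (2 * k + 1 + k ^ 2)%nat by (simpl; lia); rewrite pow_add; ring. }
    assert (Hpow : forall k, (1 <= k)%nat -> 0 < lambda ^ (2 * k + 1) <= lambda ^ k).
    { intros k Hk; split; [apply pow_lt; lra|].
      replace (2 * k + 1)%nat with (k + (k + 1))%nat by lia; rewrite pow_add.
      pose proof (pow_lt lambda k ltac:(lra)); pose proof (pow_incr lambda 1 (k + 1) ltac:(lra)) as H1.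
      rewrite pow1 in H1; nra. }
    split; [split; [apply boundary_C1_setK; exact Halpha|]|].
    (* The shift skips index 0, where the formula for [alpha] is not assumed. *)
    + apply (not_boundary_C11 alpha Halpha), is_lim_seq_incr_1.
      apply (is_lim_seq_le_le (fun _ => 0) _ (fun n => lambda ^ S n)).
      * intros n; rewrite Hstep by lia; pose proof (alpha_pos alpha Halpha (S n) ltac:(lia)).
        replace (_ * _ / _) with (lambda ^ (2 * S n + 1)) by (field; lra).
        pose proof (Hpow (S n) ltac:(lia)); lra.
      * apply is_lim_seq_const.
      * apply (is_lim_seq_incr_1 (fun n => lambda ^ n)), is_lim_seq_geom; rewrite Rabs_pos_eq; lra.
    (* Consecutive ratios are at most 1/4, so alpha (S k) + delta (S k) <= (3/2) alpha (S k) <=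
       (3/8) alpha k <= (3/4) beta k. *)
    + apply (not_ex_dir_derive_proj alpha Halpha (3 / 4)); [lra|].
      intros k Hk; unfold delta, beta.
      pose proof (alpha_pos alpha Halpha k Hk); pose proof (alpha_pos alpha Halpha (S k) ltac:(lia)).
      pose proof (alpha_pos alpha Halpha (S (S k)) ltac:(lia)).
      assert (Hq : lambda ^ (2 * k + 1) <= 1 / 4).
      { replace (2 * k + 1)%nat with (2 + (2 * k - 1))%nat by lia; rewrite pow_add.
        pose proof (pow_incr lambda 1 (2 * k - 1) ltac:(lra)) as H3; rewrite pow1 in H3.
        pose proof (pow_lt lambda (2 * k - 1) ltac:(lra)); simpl (lambda ^ 2); nra. }
      assert (alpha (S k) <= 1 / 4 * alpha k) by (rewrite Hstep by exact Hk; nra).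
      lra.
Qed.
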